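(* Let $X_1,\dots,X_k$ ($k\ge1$) be nonempty compact metric spaces. Every compact metric space $Y$ which can be equipped with a countably infinite family $\mathcal Y=\mathcal Y_1\sqcup\dots\sqcup\mathcal Y_k$ of subsets satisfying conditions (a1)–(a5) below is homeomorphic to the dense amalgam $\widetilde\sqcup(X_1,\dots,X_k)$: (a1) the members of $\mathcal Y$ are pairwise disjoint, and for each $i$ every member of $\mathcal Y_i$ is a subspace homeomorphic to $X_i$; (a2) $\mathcal Y$ is null: for any metric on $Y$ compatible with its topology, the diameters of the members of $\mathcal Y$ converge to $0$ (i.e. for every $\varepsilon>0$ only finitely many members have diameter $\ge\varepsilon$); (a3) each $Z\in\mathcal Y$ is a boundary subset of $Y$ (its complement is dense in $Y$); (a4) for each $i$, the union $\bigcup\mathcal Y_i$ is dense in $Y$; (a5) any two points of $Y$ which do not belong to the same member of $\mathcal Y$ can be separated by a subset $H\subset Y$ which is open, closed and $\mathcal Y$-saturated (every member of $\mathcal Y$ is either contained in $H$ or disjoint from $H$).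
   Context: Dense amalgam. Let $X$ be a nonempty compact metric space. A peripheral extension of $X$ is a compact metrizable space $\ddot X$ containing a countably infinite discrete subset $P$ which is open and dense in $\ddot X$, such that $\ddot X\setminus P$ is homeomorphic to $X$; it exists and is unique up to a homeomorphism that is the identity on $X$. Let $T$ be the countable tree in which every vertex has infinite valence, $V_T$ its vertex set, and for $t\in V_T$ let $N_t$ be the set of oriented edges $[t,s]$ of $T$ with initial vertex $t$. A complete tree system $\Theta$ of peripheral extensions of $X$ consists of, for each $t\in V_T$, a copy $X_t$ of $X$ with a peripheral extension $\ddot X_t$ and peripheral set $P_t=\ddot X_t\setminus X_t$, together with a bijection $b_t:N_t\to P_t$. For a finite subtree $F\subset T$ let $\vee_F\Theta$ be the quotient of $\bigsqcup_{t\in V_F}\ddot X_t$ by the identifications $b_t([t,s])\sim b_s([s,t])$ for all edges $[t,s]$ of $F$. For finite subtrees $F'\subset F$, let $\rho_{F,F'}:\vee_F\Theta\to\vee_{F'}\Theta$ be the identity on $\vee_{F'}\Theta$ and, for $s\in V_F\setminus V_{F'}$ and $x\in\ddot X_s$, $\rho_{F,F'}(x)=b_t([t,t'])$, where $t$ is the vertex of $F'$ nearest to $s$ and $t'$ is the vertex adjacent to $t$ on the geodesic from $t$ to $s$. The wedge $\vee\Theta$ is the inverse limit of the system $(\vee_F\Theta,\rho_{F,F'})$ over finite subtrees of $T$. Let $P_\Theta\subset\vee\Theta$ be the set of points represented by $b_t(e)$, $t\in V_T$, $e\in N_t$. The dense amalgam $\widetilde\sqcup(X)$ is $\vee\Theta\setminus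 P_\Theta$ (well defined up to homeomorphism). For nonempty compact metric spaces $X_1,\dots,X_k$, $\widetilde\sqcup(X_1,\dots,X_k):=\widetilde\sqcup(X_1\sqcup\dots\sqcup X_k)$. *)

(* Defs.v *)
From HB Require Import structures.
From mathcomp Require Import all_boot all_order all_algebra generic_quotient.
From mathcomp Require Import all_classical all_reals.
From mathcomp Require Import topology_theory.topology topology_theory.sigT_topology
  topology_theory.quotient_topology topology_theory.subtype_topology
  topology_theory.function_spaces.
From Stdlib Require Import Relation_Operators.

Set Implicit Arguments.
Unset Strict Implicit.
Unset Printing Implicit Defensive.

Import Order.TTheory GRing.Theory Num.Theory.
Local Open Scope classical_set_scope.
Local Open Scope ring_scope.
Local Open Scope quotient_scope.

Definition homeomorphic (S T : topologicalType) : Prop :=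
  exists (f : S -> T) (g : T -> S),
    [/\ cancel f g, cancel g f, continuous f & continuous g].

Definition vertex := seq nat.

Definition parentb (s t : vertex) : bool :=
  (size t == (size s).+1) && (take (size s) t == s).

Definition adjb (s t : vertex) : bool := parentb s t || parentb t s.

Fixpoint lcp (s t : vertex) : vertex :=
  match s, t with
  | x :: s', y :: t' => if x == y then x :: lcp s' t' else [::]
  | _, _ => [::]
  end.

Definition tdist (s t : vertex) : nat := (size s + size t - (size (lcp s t)).*2)%N.

Definition finite_subtree (F : set vertex) : Prop :=
  [/\ finite_set F, F !=set0 &
      forall s t, F s -> F t -> exists p : seq vertex,
        [/\ path adjb s p, last s p = t & forall u, u \in p -> F u]].

Definition fsubtree := {F : set vertex | finite_subtree F}.
Definition fsval (F : fsubtree) : set vertex := proj1_sig F.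

Definition nearest (F : set vertex) (s t : vertex) : Prop :=
  F t /\ forall v, F v -> (tdist t s <= tdist v s)%N.

Definition toward (t s t' : vertex) : Prop :=
  adjb t t' /\ (tdist t' s < tdist t s)%N.

Section Wedge.
Context {E : topologicalType} (b : vertex -> vertex -> E).

Definition Dall := {t : vertex & (fun _ : vertex => E) t}.

Definition Dset (F : set vertex) : set Dall := [set d | F (projT1 d)].
Definition DF (F : set vertex) := set_type (Dset F).

Definition ident (F : set vertex) (a c : DF F) : Prop :=
  exists t s, [/\ adjb t s,
    (set_val a = existT _ t (b t s) :> Dall) &
    (set_val c = existT _ s (b s t) :> Dall)].

Definition identb F (a c : DF F) : bool :=
  `[< clos_refl_sym_trans _ (@ident F) a c >].

Lemma identb_refl F : reflexive (@identb F).
Proof. by move=> a; apply/asboolP; apply: rst_refl. Qed.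
Lemma identb_sym F : symmetric (@identb F).
Proof.
move=> a c; apply/asboolP/asboolP => h; exact: rst_sym.
Qed.
Lemma identb_trans F : transitive (@identb F).
Proof.
move=> c a d /asboolP h1 /asboolP h2; apply/asboolP; exact: rst_trans h1 h2.
Qed.

Definition ident_equiv F : equiv_rel (DF F) :=
  EquivRel (@identb F) (@identb_refl F) (@identb_sym F) (@identb_trans F).

Definition finwedge (F : set vertex) := quotient_topology {eq_quot (ident_equiv F)}.

Definition wedge_prod := prod_topology (fun F : fsubtree => finwedge (fsval F)).

Definition rho_rel (F' : set vertex) (d d' : Dall) : Prop :=
  (F' (projT1 d) /\ d' = d) \/
  (~ F' (projT1 d) /\ exists t t', [/\ nearest F' (projT1 d) t,
       toward t (projT1 d) t' & d' = existT _ t (b t t')]).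

Definition wedge_set : set wedge_prod :=
  [set th | forall (F F' : fsubtree), fsval F' `<=` fsval F ->
     forall (r : DF (fsval F)) (r' : DF (fsval F')),
       \pi_(finwedge (fsval F)) r = th F ->
       rho_rel (fsval F') (set_val r) (set_val r') ->
       \pi_(finwedge (fsval F')) r' = th F'].

Definition periph_set : set wedge_prod :=
  [set th | exists t s, adjb t s /\
     forall (F : fsubtree), fsval F t ->
     forall r : DF (fsval F), set_val r = existT _ t (b t s) :> Dall ->
       th F = \pi_(finwedge (fsval F)) r].

Definition dense_amalgam_set : set wedge_prod := wedge_set `\` periph_set.
End Wedge.

(* Main.v *)
Require Import Defs.
From HB Require Import structures.
From mathcomp Require Import all_boot all_order all_algebra generic_quotient.
From mathcomp Require Import all_classical all_reals.
From mathcomp Require Import topology_theory.topology topology_theory.sigT_topology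
  topology_theory.quotient_topology topology_theory.subtype_topology
  topology_theory.function_spaces.
From mathcomp Require Import zify lra.
From Stdlib Require Import Relation_Operators.

(** A point of the dense amalgam is a family (x_t) of points of the extended
spaces, one for each vertex t of the tree, such that for every edge exactly one
of its two ends t sees the point through that edge (x_t = b_t(e)).  So it is
enough to find continuous maps psi_t : Y -> E that form such a family at every
point of Y, and through which every such family comes from a unique point.

They are built down the tree.  A clopen saturated region H of Y contains members
of every Y_i; pick one of each kind, of least index, and call their union the
core of H.  The rest of H is partitioned into clopen saturated children that
shrink to points of the core and accumulate on all of it, so collapsing the
children turns H into a peripheral extension of the core, and a
Schroeder-Bernstein matching of the children with the peripheral points makes
this extension homeomorphic to that of X_1 + ... + X_k.  Least indices exhaust
the family, and each child is an atom of a fixed enumeration of the clopen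
saturated sets; hence by (a5) an infinite nested sequence of regions meets in
one point, an end of the tree.  *)

Set Implicit Arguments.
Unset Strict Implicit.
Unset Printing Implicit Defensive.

Import Order.TTheory GRing.Theory Num.Theory.
Local Open Scope classical_set_scope.

(** * Geodesics in the tree *)

Lemma parentbP (s t : vertex) : reflect (exists n, t = rcons s n) (parentb s t).
Proof.
apply: (iffP andP) => [[/eqP sz /eqP tk]|[n ->]].
  case/lastP: t sz tk => [//|t n]; rewrite size_rcons => -[sz].
  by rewrite -cats1 take_size_cat // => <-; exists n; rewrite cats1.
by rewrite size_rcons -cats1 take_size_cat.
Qed.

Lemma adjb_rcons (t : vertex) n : adjb t (rcons t n).
Proof. by rewrite /adjb; apply/orP; left; apply/parentbP; exists n. Qed.

Lemma adjbC (s t : vertex) : adjb s t = adjb t s.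
Proof. by rewrite /adjb orbC. Qed.

Lemma adjbP (s t : vertex) :
  adjb s t -> (exists n, t = rcons s n) \/ (exists n, s = rcons t n).
Proof. by case/orP => /parentbP; [left|right]. Qed.

Lemma adjb_irr (t : vertex) : adjb t t = false.
Proof.
by apply/negP => /adjbP [] [n /(congr1 size)]; rewrite size_rcons; lia.
Qed.

Lemma size_lcp (s t : vertex) : size (lcp s t) <= size s /\ size (lcp s t) <= size t.
Proof.
elim: s t => [|x s IH] [|y t] //=; case: ifP => //= _.
by have := IH t; lia.
Qed.

Lemma lcpss (s : vertex) : lcp s s = s.
Proof. by elim: s => //= x s ->; rewrite eqxx. Qed.

Lemma size_lcp_rcons (u s : vertex) n :
  size (lcp (rcons u n) s) = size (lcp u s) + prefix (rcons u n) s.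
Proof.
elim: u s => [|x u IH] [|y s] //=.
  by rewrite prefix0s andbT; case: eqP.
by case: eqP => //= _; rewrite IH.
Qed.

Lemma prefix_rconsl (u s : vertex) n : prefix (rcons u n) s -> prefix u s.
Proof. by apply: prefix_trans; rewrite prefix_rcons. Qed.

Lemma tdist_rcons (u s : vertex) n :
  if prefix (rcons u n) s then tdist u s = (tdist (rcons u n) s).+1
  else tdist (rcons u n) s = (tdist u s).+1.
Proof.
have [] := size_lcp u s; have [] := size_lcp (rcons u n) s.
rewrite /tdist size_lcp_rcons size_rcons.
by case: (prefix (rcons u n) s) => /=; lia.
Qed.

Lemma tdistxx (s : vertex) : tdist s s = 0.
Proof. by rewrite /tdist lcpss; lia. Qed.

(* The neighbour of [u] on the geodesic to [s] (meaningless if [u = s]). *)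
Definition tw (u s : vertex) : vertex :=
  if prefix u s then take (size u).+1 s else take (size u).-1 u.

Lemma tw_rcons (u s : vertex) n : prefix (rcons u n) s -> tw u s = rcons u n.
Proof.
move=> p; rewrite /tw (prefix_rconsl p).
by move: p; rewrite prefixE size_rcons => /eqP.
Qed.

Lemma tw_parent (u s : vertex) n : ~~ prefix (rcons u n) s -> tw (rcons u n) s = u.
Proof.
move=> /negbTE p; rewrite /tw p size_rcons /=.
by rewrite -cats1 take_size_cat.
Qed.

Lemma twP (u s : vertex) : u <> s ->
  (exists n, prefix (rcons u n) s /\ tw u s = rcons u n) \/
  (exists v n, [/\ u = rcons v n, ~~ prefix u s & tw u s = v]).
Proof.
move=> us; have [|np] := boolP (prefix u s).
  case/prefixP => -[|x r] e; first by rewrite cats0 in e; case: us.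
  have p : prefix (rcons u x) s by apply/prefixP; exists r; rewrite e cat_rcons.
  by left; exists x; split => //; exact: tw_rcons.
right; case/lastP: u us np => [|v n] us np; first by rewrite prefix0s in np.
by exists v, n; split => //; exact: tw_parent.
Qed.

Lemma adjb_tw (u s : vertex) : u <> s -> adjb u (tw u s).
Proof.
case/twP => [[n [_ ->]]|[v [n [-> _ ->]]]]; first exact: adjb_rcons.
by rewrite adjbC adjb_rcons.
Qed.

Lemma tdist_adj (u v s : vertex) : u <> s -> adjb u v ->
  if v == tw u s then tdist u s = (tdist v s).+1 else tdist v s = (tdist u s).+1.
Proof.
move=> us /adjbP [] [n e].
- have := tdist_rcons u s n; rewrite -e.
  case: ifPn => p; first by rewrite (tw_rcons (n := n)) -?e // eqxx.
  suff -> : (v == tw u s) = false by [].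
  apply/eqP => ev; have [[m [pm em]]|[w [m [eu _ ew]]]] := twP us.
    by move: p; rewrite ev em pm.
  by have := congr1 size e; rewrite ev ew eu !size_rcons; lia.
- have := tdist_rcons v s n; rewrite -e.
  case: ifPn => p; last by rewrite e tw_parent -?e // eqxx.
  suff -> : (v == tw u s) = false by [].
  apply/eqP => ev; have [[m [pm em]]|[w [m [eu np ew]]]] := twP us.
    by have := congr1 size e; rewrite ev em !size_rcons; lia.
  by rewrite p in np.
Qed.

Lemma tdist_adjS (u v s : vertex) : adjb u v ->
  tdist u s = (tdist v s).+1 \/ tdist v s = (tdist u s).+1.
Proof.
move=> uv; have [us|us] := pselect (u = s).
  subst u; case/adjbP: uv => -[n e].
    have := tdist_rcons s s n; rewrite -e; case: ifP => _; by [left|right].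
  have := tdist_rcons v s n; rewrite -e; case: ifP => _; by [left|right].
by have := tdist_adj us uv; case: ifP => _; [left|right].
Qed.

Lemma towardP (u s v : vertex) : u <> s -> toward u s v <-> v = tw u s.
Proof.
move=> us; split => [[uv]|->].
  by have := tdist_adj us uv; case: eqP => // _; lia.
have uv := adjb_tw us; split => //.
by have := tdist_adj us uv; rewrite eqxx; lia.
Qed.

Lemma tw_adj (u v : vertex) : adjb u v -> tw u v = v.
Proof.
move=> uv; have us : u <> v by move=> e; rewrite e adjb_irr in uv.
apply/esym/(towardP v us); split => //.
by have := tdist_adjS v uv; rewrite tdistxx; lia.
Qed.

Lemma tw_tw (u s : vertex) : u <> s -> tw u s <> s -> tw (tw u s) s <> u.
Proof.
move=> us vs e.
have [uv] : toward u s (tw u s) by apply/towardP.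
have [_] : toward (tw u s) s u by apply/towardP.
by lia.
Qed.

(** Deleting [u] does not cut the edge from [t] to [s], so its ends stay in one branch at [u]. *)
Lemma tw_adj_eq (u t s : vertex) : adjb t s -> u <> t -> u <> s -> tw u t = tw u s.
Proof.
wlog [n ->] : t s / exists n, s = rcons t n.
  move=> W; case/adjbP => e ut us; last apply/esym; apply: W => //.
    by case: e => n ->; apply: adjb_rcons.
  by case: e => n ->; apply: adjb_rcons.
move=> _ ut us; case: (twP ut) => [[m [p ->]]|[v [m [e np ->]]]].
  by rewrite (tw_rcons (n := m)) //; apply: prefix_trans p _; rewrite prefix_rcons.
rewrite e tw_parent // -e; apply/negP => /prefixP [r].
case/lastP: r => [|r k]; first by rewrite cats0 => /esym.
rewrite -rcons_cat => /rcons_inj [et _].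
by move/negP: np; apply; apply/prefixP; exists r.
Qed.

(** Along a walk in [F] from [u] to [c] the branch at [u] can change only at a visit to [u], so the
    vertex after the last visit is the neighbour towards [c]. *)
Lemma subtree_tw (F : set vertex) (u c : vertex) : finite_subtree F ->
  F u -> F c -> u <> c -> F (tw u c).
Proof.
case=> _ _ con Fu Fc uc; have [p [pth lst pF]] := con u c Fu Fc.
apply: pF; suff : forall w, path adjb w p -> last w p = c ->
  (w <> u -> tw u c \in p \/ tw u w = tw u c) /\ (w = u -> tw u c \in p).
  by move=> /(_ u pth lst) [_]; exact.
elim: p {pth lst} => [|v p IH] w /=.
  by move=> _ wc; split => [_|wu]; [right; rewrite wc | case: uc; rewrite -wu].
case/andP => wv /IH {}IH /IH [IH1 IH2]; rewrite inE; split => wu.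
  have [vu|vu] := pselect (v = u); first by left; rewrite IH2 // orbT.
  have [->|<-] := IH1 vu; first by left; rewrite orbT.
  by right; apply: tw_adj_eq => // /esym.
have vu : v <> u by move=> e; rewrite wu e adjb_irr in wv.
have [->|<-] := IH1 vu; first by rewrite orbT.
by rewrite tw_adj ?eqxx // -wu.
Qed.

Lemma finite_subtree1 (t : vertex) : finite_subtree [set t].
Proof.
split; [exact: finite_set1|by exists t|].
by move=> ? ? -> ->; exists [::]; split.
Qed.

Lemma finite_subtree2 (t s : vertex) : adjb t s -> finite_subtree [set t; s].
Proof.
move=> ts; split; [exact: finite_set2|by exists t; left|].
have st : adjb s t by rewrite adjbC.
move=> u v [] -> [] ->; [exists [::]|exists [:: s]|exists [:: t]|exists [::]];
  split => //=; rewrite ?ts ?st // => w; rewrite inE => /eqP ->; by [left|right].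
Qed.

Definition fs1 (t : vertex) : fsubtree := exist _ _ (finite_subtree1 t).
Definition fs2 (t s : vertex) (ts : adjb t s) : fsubtree :=
  exist _ _ (finite_subtree2 ts).

(** * The wedge in coordinates *)

Lemma finite_argmax (T : choiceType) (A : set T) (f : T -> nat) :
  finite_set A -> A !=set0 -> exists2 c, A c & forall u, A u -> f u <= f c.
Proof.
move=> /finite_seqP [s ->] [x xs].
have {x xs} : s != [::] by move: xs; case: s.
elim: s => //= a s IH _; have [->|/IH [c cs cm]] := eqVneq s [::].
  by exists a => [|u] /=; rewrite inE // => /eqP ->.
have [le|lt] := leqP (f a) (f c).
  exists c => [|u] /=; rewrite inE ?(cs : c \in s) ?orbT // => /orP [/eqP -> //|].
  exact: cm.
exists a => [|u] /=; rewrite inE ?eqxx // => /orP [/eqP -> //|/cm]; lia.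
Qed.

Section Wedge.
Local Open Scope quotient_scope.
Context {E : topologicalType} (P : set E) (b : vertex -> vertex -> E).
Hypothesis hb : forall t, set_bij [set s | adjb t s] P (b t).

Let b_inj t s s' : adjb t s -> adjb t s' -> b t s = b t s' -> s = s'.
Proof.
by move=> ts ts'; have [_ inj _] := hb t; apply: inj; rewrite inE.
Qed.

(* The image of [d] under rho_{F,{u}}, read in the copy of [E] at [u]. *)
Definition side (u : vertex) (d : @Dall E) : E :=
  if projT1 d == u then projT2 d else b u (tw u (projT1 d)).

Definition mkDF (F : set vertex) t (Ft : F t) (e : E) : @DF E F :=
  SigSub (mem_set (Ft : @Dset E F (existT _ t e))).

Lemma mkDFE F (r : @DF E F) : exists t Ft e, r = @mkDF F t Ft e.
Proof.
case: r => -[t e] p; have Ft : F t by exact: (set_mem p).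
by exists t, Ft, e; apply/val_inj.
Qed.

Lemma pi_identP F (a c : @DF E F) :
  \pi_(finwedge b F) a = \pi_(finwedge b F) c <-> identb b a c.
Proof.
have := @eqmodP _ (ident_equiv b F) a c => h.
by split => [/h|h1]; [|apply/h].
Qed.

(** Glued points read alike: at an end of their edge, as the peripheral point of that edge; at any
    other [u], because the two ends lie in one branch. *)
Lemma side_pi F (a c : @DF E F) : \pi_(finwedge b F) a = \pi_(finwedge b F) c ->
  forall u, side u (set_val a) = side u (set_val c).
Proof.
move=> /pi_identP /asboolP h u; elim: h => {a c}
  [a c [t [s [ts -> ->]]]|//|//|a c d _ -> //]; rewrite /side /=.
have st : adjb s t by rewrite adjbC.
case: eqP => [tu|tu]; case: eqP => [su|su] //.
- by move: ts; rewrite tu su adjb_irr.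
- by rewrite -tu tw_adj.
- by rewrite -su tw_adj.
- by rewrite (@tw_adj_eq u t s) // => /esym.
Qed.

(* At exactly one end of each edge the point is seen through the edge; for
peripheral points of the wedge this holds at both ends. *)
Definition coherent (x : vertex -> E) :=
  forall t s, adjb t s -> (x t = b t s <-> x s <> b s t).

(* The vertices of [F] whose extended space contains the image of [x] in the wedge over [F]. *)
Definition central (F : set vertex) (x : vertex -> E) (c : vertex) :=
  F c /\ forall u, F u -> adjb c u -> x u = b u c.

Lemma central_exists F x : finite_subtree F -> coherent x -> exists c, central F x c.
Proof.
move=> [fF F0 _] cx.
(* [t] is in [U] iff the point is not seen from [t] through its parent; the deepest
such vertex of [F], or else the top vertex of [F], is central *)
pose U : set vertex := [set t | forall s n, t = rcons s n -> x t <> b t s].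
have [FU0|nFU] := pselect (F `&` U !=set0).
  have [|c [Fc Uc] cm] := @finite_argmax _ (F `&` U) size _ FU0.
    exact: finite_setIl.
  exists c; split => // u Fu /adjbP [] [n e].
    apply: contrapT => xu; have /cm : (F `&` U) u.
      by split => // s m es; move: es; rewrite e => /rcons_inj [<- _]; rewrite -e.
    by rewrite e size_rcons; lia.
  apply/(cx u c); first by rewrite e adjb_rcons.
  exact: Uc e.
have [m [Mm mF]] : exists m, (exists2 c, F c & size c = m) /\ forall u, F u -> m <= size u.
  have [c0 Fc0] := F0.
  have ex : exists n, `[< exists2 c, F c & size c = n >].
    by exists (size c0); apply/asboolP; exists c0.
  exists (ex_minn ex); case: ex_minnP => m /asboolP hm mm; split => // u Fu.
  by apply: mm; apply/asboolP; exists u.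
case: Mm => c Fc cm; exists c; split => // u Fu /adjbP [] [n e].
  apply: contrapT => xu; apply: nFU; exists u; split => // s k es.
  by move: es; rewrite e => /rcons_inj [<- _]; rewrite -e.
by have := mF _ Fu; rewrite -cm e size_rcons; lia.
Qed.

(** Convexity without finiteness, so that half-trees and the whole tree are covered too. *)
Definition tw_closed (F : set vertex) :=
  forall u v, F u -> F v -> u <> v -> F (tw u v).

(** Induction on the distance to [c]. If [u] did not see the point through the edge to its
    successor, the successor would see it through [u], while by induction it sees it towards [c]; a
    geodesic does not turn back. *)
Lemma central_far F x c : tw_closed F -> coherent x -> central F x c ->
  forall u, F u -> u <> c -> x u = b u (tw u c).
Proof.
move=> sF cx [Fc cc] u; move: {2}(tdist u c).+1 (ltnSn (tdist u c)) => n.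
elim: n u => // n IH u un Fu uc.
have [ut] : toward u c (tw u c) by apply/towardP.
have Fv := sF _ _ Fu Fc uc.
have vu : adjb (tw u c) u by rewrite adjbC.
have [e|vc] := pselect (tw u c = c); first by rewrite e cc // -e.
move=> lt; apply/(cx u (tw u c)) => // xv.
have := IH _ _ Fv vc; rewrite xv => /(_ _) h.
have := @tw_tw u c uc vc; apply.
by apply/esym/(@b_inj (tw u c)) => //; [exact: adjb_tw | apply: h; lia].
Qed.

Lemma subtree_tw_closed F : finite_subtree F -> tw_closed F.
Proof. by move=> sF u v; exact: subtree_tw. Qed.

(** Otherwise both ends of the first edge from [c] towards [c'] would see the point through that
    edge. *)
Lemma central_uniq F x c c' : finite_subtree F -> coherent x ->
  central F x c -> central F x c' -> c = c'.
Proof.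
move=> sF cx zc zc'; apply: contrapT => cc'.
have [Fc hc] := zc; have [Fc' _] := zc'.
have Fv := subtree_tw sF Fc Fc' cc'.
have a := adjb_tw cc'.
by have /(cx _ _ a) := central_far (subtree_tw_closed sF) cx zc' Fc cc'; apply; exact: hc.
Qed.

(** A nonperipheral coordinate makes [t] central in the whole tree, and [central_far] then computes
    all other coordinates. *)
Lemma coherent_eq_nonP x x' t : coherent x -> coherent x' ->
  x t = x' t -> ~ P (x t) -> forall u, x u = x' u.
Proof.
move=> cx cx' xt nP u; have [->//|ut] := pselect (u = t).
have tT : tw_closed setT by [].
have bP v : adjb t v -> P (b t v) by have [+ _ _] := hb t; apply.
have zx y : coherent y -> ~ P (y t) -> central setT y t.
  move=> cy nPy; split => // v _ tv; apply/(cy v t); first by rewrite adjbC.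
  by move=> e; apply: nPy; rewrite e; exact: bP.
rewrite (central_far tT cx (zx _ cx nP)) //.
by rewrite (central_far tT cx' (zx _ cx' _)) // -xt.
Qed.

(** Cutting the edge from [c] to [d] leaves a half-tree in which [c] is central, so [central_far]
    applies there. *)
Lemma coherent_branch x c d : coherent x -> adjb c d -> x c = b c d ->
  forall u, u <> c -> tw c u <> d -> x u = b u (tw u c).
Proof.
move=> cx side xc u uc ud.
pose F : set vertex := [set u | u = c \/ tw c u <> d].
have cF : tw_closed F.
  move=> v w Fv Fw vw; have [->|wc] := pselect (tw v w = c); [by left|right].
  have [vc|vc] := pselect (v = c); last first.
    case: Fv => // vd; rewrite -(@tw_adj_eq c v) //; first exact: adjb_tw.
      by move/esym.
    by move/esym.
  subst v; rewrite tw_adj; last exact: adjb_tw.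
  by case: Fw => // wc'; case: vw.
apply: (central_far cF cx) => //; last by right.
split; first by left.
move=> v Fv cv; apply/(cx v c); first by rewrite adjbC.
rewrite xc => e; have dv := b_inj side cv e; subst v.
case: Fv => [dc|]; first by move: (side); rewrite dc adjb_irr.
by rewrite tw_adj.
Qed.

(** An infinite descending ray determines the family that follows it: by its length [u] cannot lie
    at or below the ray's vertex of depth [size u + 1], so [coherent_branch] applies at depth
    [size u]. *)
Lemma coherent_eq_end x x' (f : nat -> vertex) : coherent x -> coherent x' ->
  (forall n, size (f n) = n) -> (forall n, exists m, f n.+1 = rcons (f n) m) ->
  (forall n, x (f n) = b (f n) (f n.+1)) -> (forall n, x' (f n) = b (f n) (f n.+1)) ->
  forall u, x u = x' u.
Proof.
move=> cx cx' fs fr fx fx' u; set c := f (size u).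
have [->|uc] := pselect (u = c); first by rewrite fx fx'.
have side : adjb c (f (size u).+1) by have [m ->] := fr (size u); exact: adjb_rcons.
have ud : tw c u <> f (size u).+1.
  have [m em] := fr (size u); rewrite em => e.
  have [|[n [/size_prefix]]|[v [n [ce _ ev]]]] := @twP c u.
  - by move/esym.
  - by rewrite size_rcons fs ltnn.
  - have := congr1 size ce; have := congr1 size e.
    by rewrite ev !size_rcons; move: (size c) (size v); lia.
by rewrite (coherent_branch cx side (fx _)) // (coherent_branch cx' side (fx' _)).
Qed.

Lemma rho_relE F' (d d' : @Dall E) : rho_rel b F' d d' ->
  F' (projT1 d') /\ (F' (projT1 d) /\ d' = d \/
   exists t, [/\ ~ F' (projT1 d), t <> projT1 d, nearest F' (projT1 d) t &
     d' = existT _ t (b t (tw t (projT1 d)))]).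
Proof.
case=> [[Fd ->]|[nF [t [t' [nr tt' ->]]]]]; first by split => //; left.
have [Ft _] := nr; split => //; right; exists t.
have td : t <> projT1 d by move=> e; rewrite -e in nF.
by split => //; rewrite -((towardP t' td).1 tt').
Qed.

Lemma rho_rel1 t (d : @Dall E) : rho_rel b [set t] d (existT _ t (side t d)).
Proof.
have [e|ne] := pselect (projT1 d = t).
  by left; split => //; rewrite /side e eqxx; case: d e => /= s e <-.
right; split => //=; exists t, (tw t (projT1 d)).
have td : t <> projT1 d by move=> e; apply: ne.
split; [by split => // v -> | exact/towardP | ].
by rewrite /side; case: eqP.
Qed.

Definition thread (x : vertex -> E) (th : wedge_prod b) :=
  forall F : fsubtree, exists (c : vertex) (Fc : fsval F c),
    central (fsval F) x c /\ th F = \pi_(finwedge b (fsval F)) (mkDF Fc (x c)).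

Lemma central_side (F : fsubtree) x c e : coherent x -> central (fsval F) x c ->
  e = x c -> forall u, fsval F u -> x u = side u (existT _ c e).
Proof.
move=> cx zc -> u Fu; rewrite /side /=; case: eqP => [->//|/eqP cu].
by apply: (central_far (subtree_tw_closed (proj2_sig F)) cx zc Fu) => uc; rewrite uc eqxx in cu.
Qed.

Lemma side_central (F : fsubtree) x (r : @DF E (fsval F)) :
  (forall u, fsval F u -> x u = side u (set_val r)) ->
  exists c Fc, central (fsval F) x c /\ r = @mkDF _ c Fc (x c).
Proof.
have [c [Fc [e ->]]] := mkDFE r; rewrite /side /= => h; exists c, Fc.
have xc : x c = e by rewrite h // eqxx.
split; last by rewrite xc.
split => // u Fu cu; rewrite h //; case: eqP => [cu'|_].
  by rewrite cu' adjb_irr in cu.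
by rewrite tw_adj // adjbC.
Qed.

Lemma thread_pi x th (F : fsubtree) c (Fc : fsval F c) : coherent x -> thread x th ->
  central (fsval F) x c -> th F = \pi_(finwedge b (fsval F)) (mkDF Fc (x c)).
Proof.
move=> cx /(_ F) [c' [Fc' [zc' ->]]] zc.
have e := central_uniq (proj2_sig F) cx zc' zc; subst c'.
by congr (\pi_(_) (mkDF _ _)); exact: Prop_irrelevance.
Qed.

Lemma thread_side x th (F : fsubtree) (r : @DF E (fsval F)) : coherent x -> thread x th ->
  th F = \pi_(finwedge b (fsval F)) r ->
  forall u, fsval F u -> x u = side u (set_val r).
Proof.
move=> cx /(_ F) [c [Fc [zc ->]]] /side_pi h u Fu.
by rewrite -h; apply: central_side cx zc _ _ Fu.
Qed.

Lemma thread_exists x : coherent x -> exists th, thread x th.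
Proof.
move=> cx.
have h (F : fsubtree) : exists q : finwedge b (fsval F),
   exists (c : vertex) (Fc : fsval F c),
    central (fsval F) x c /\ q = \pi_(finwedge b (fsval F)) (mkDF Fc (x c)).
  have [c zc] := central_exists (proj2_sig F) cx.
  by exists (\pi_(finwedge b (fsval F)) (mkDF zc.1 (x c))), c, zc.1.
by exists (fun F => projT1 (cid (h F))) => F; exact: (projT2 (cid (h F))).
Qed.

Lemma thread_uniq x th th' : coherent x -> thread x th -> thread x th' -> th = th'.
Proof.
move=> cx h h'; apply: functional_extensionality_dep => F.
have [c [Fc [zc ->]]] := h F.
by rewrite (thread_pi Fc cx h' zc).
Qed.

Lemma thread_amalgam x th : coherent x -> thread x th -> dense_amalgam_set th.
Proof.
move=> cx hth; split.
  move=> F F' FF r r' pr rr; have rc := thread_side cx hth (esym pr).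
  apply/esym; suff : forall u, fsval F' u -> x u = side u (set_val r').
    move=> /side_central [c [Fc [zc ->]]]; exact: thread_pi.
  have [c [Fc [zc er]]] := side_central rc; subst r.
  have [F'd [[F'c e]|[t [nF' tc nr e]]]] := rho_relE rr.
    by move=> u F'u; rewrite e rc //; apply: FF.
  move=> u F'u; rewrite e /=; move: nF' tc nr e => /= nF' tc [F't nr] e.
  have xt : x t = b t (tw t c).
    by rewrite rc ?/side /=; [case: eqP => // /esym|exact: FF].
  apply: (@central_side F' x t) => //.
  (* Since [t] is nearest to [c] in [F'], a neighbour [v] of [t] in [F'] is farther away and has [t]
     as its next vertex towards [c]. *)
  split => // v F'v tv; rewrite rc ?/side /=; last exact: FF.
  case: eqP => [cv|cv]; first by rewrite cv in nF'.
  congr (b _ _); apply/esym/towardP; first by move/esym.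
  split; first by rewrite adjbC.
  by have := nr v F'v; have := tdist_adjS c tv; lia.
(* A peripheral point would be seen through its edge from both ends, as its value over the
   two-vertex subtree shows. *)
move=> [t [s [ts h]]].
have := h (fs2 ts) (or_introl erefl) (mkDF (or_introl erefl) (b t s)) erefl.
move=> /(thread_side cx hth) hc.
have xt : x t = b t s by rewrite hc; [rewrite /side /= eqxx|left].
have st : adjb s t by rewrite adjbC.
move/(cx t s ts): xt; apply; rewrite hc; last by right.
rewrite /side /=; case: eqP => [e|_]; first by move: (ts); rewrite e adjb_irr.
by rewrite tw_adj.
Qed.

Lemma amalgam_thread th : dense_amalgam_set th ->
  exists2 x, coherent x & thread x th.
Proof.
move=> [wth nper].
have /choice [x hx] : forall t, exists e : E,
    th (fs1 t) = \pi_(finwedge b [set t]) (@mkDF [set t] t erefl e).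
  move=> t; have : \pi_(finwedge b [set t]) (repr (th (fs1 t))) = th (fs1 t).
    exact: reprK.
  have [s [st [e ->]]] := mkDFE (repr (th (fs1 t))) => <-.
  have est : s = t := st; subst s; exists e.
  by congr (\pi_(_) (mkDF _ _)); exact: Prop_irrelevance.
have hcd (F : fsubtree) (r : @DF E (fsval F)) :
    \pi_(finwedge b (fsval F)) r = th F ->
    forall u, fsval F u -> x u = side u (set_val r).
  move=> pr u Fu.
  have sF : fsval (fs1 u) `<=` fsval F by move=> _ ->.
  have := wth F (fs1 u) sF r (@mkDF [set u] u erefl (side u (set_val r))) pr.
  move=> /(_ (rho_rel1 _ _)); rewrite hx => /side_pi /(_ u).
  by rewrite /side /= eqxx.
have hr (F : fsubtree) : exists r, \pi_(finwedge b (fsval F)) r = th F.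
  by exists (repr (th F)); exact: reprK.
have cx : coherent x.
  move=> t s ts; have st : adjb s t by rewrite adjbC.
  have nts : t <> s by move=> e; rewrite e adjb_irr in ts.
  split.
    (* If both ends see the point through the edge, its representative over any [F] containing [t]
       sits at [t] or [s] and is the glued peripheral point; elsewhere, [t] and [s] would each be
       the next vertex from the other towards it. *)
    move=> xt xs; apply: nper; exists t, s; split => // F Ft r er.
    have [q pq] := hr F; rewrite -pq; have hq := hcd F q pq.
    have [u [Fu [zu eq]]] := side_central hq.
    have {}er : r = mkDF Ft (b t s) by apply: val_inj.
    rewrite eq er; have [ut|ut] := pselect (u = t).
      subst u; rewrite xt; congr (\pi_(_) (mkDF _ _)); exact: Prop_irrelevance.
    have twt : tw t u = s.
      apply: (@b_inj t) => //; first by apply: adjb_tw => /esym.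
      rewrite -xt hq // eq /side /=; by case: eqP.
    have Fs : fsval F s.
      by rewrite -twt; apply: (subtree_tw (proj2_sig F) Ft Fu) => /esym.
    have [us|us] := pselect (u = s).
      subst u; rewrite xs; apply/pi_identP/asboolP/rst_step.
      by exists s, t; split.
    exfalso; have := @tw_tw t u; rewrite twt; apply => [/esym //|/esym //|].
    apply: (@b_inj s) => //; first by apply: adjb_tw => /esym.
    by rewrite -xs hq // eq /side /=; case: eqP.
  (* The representative over the two-vertex subtree sits at one end, which the other end sees
     through the edge; by assumption that other end is not [s]. *)
  have [q pq] := hr (fs2 ts); have hq := hcd _ q pq.
  have [u [Fu [zu eq]]] := side_central hq.
  have [e|e] : u = t \/ u = s := Fu; subst u => xs.
    by exfalso; apply: xs; case: zu => _; apply => //; right.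
  by case: zu => _; apply => //; left.
exists x => // F; have [q pq] := hr F.
have [c [Fc [zc eq]]] := side_central (hcd F q pq).
by exists c, Fc; rewrite -pq -eq.
Qed.

End Wedge.

(** * Neighbourhoods, compact bijections and products *)

Lemma near_finite (I : choiceType) (T : Type) (F : set_system T) (A : set I)
    (Q : I -> T -> Prop) : Filter F -> finite_set A ->
  (forall i, A i -> \forall x \near F, Q i x) ->
  \forall x \near F, forall i, A i -> Q i x.
Proof.
move=> FF /finite_seqP [s ->]; elim: s => [|a s IH] h.
  by apply: nearW => x i; rewrite /= in_nil.
have h1 : \forall x \near F, forall i, [set` s] i -> Q i x.
  by apply: IH => i /= si; apply: h; rewrite /= inE si orbT.
have h2 : \forall x \near F, Q a x by apply: h; rewrite /= mem_head.
near=> x => i /=; rewrite inE => /orP [/eqP ->|si].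
  by near: x.
by move: i si; near: x.
Unshelve. all: by end_near. Qed.

Lemma compact_bij_homeomorphic (S T : topologicalType) (f : S -> T) :
  compact [set: S] -> hausdorff_space T -> continuous f -> injective f ->
  (forall z, exists y, f y = z) -> homeomorphic S T.
Proof.
move=> cS hT cf fi /choice [g gK]; have fK : cancel f g by move=> y; apply: fi.
exists f, g; split => //; apply/continuous_closedP => C clC.
rewrite (_ : g @^-1` C = f @` C); last first.
  by apply/seteqP; split => [z Cz|_ [y Cy <-]]; [exists (g z)|rewrite /= fK].
apply: compact_closed => //; apply: continuous_compact.
  exact: continuous_subspaceT.
exact: subclosed_compact cS _.
Qed.

Lemma prod_proj_continuous (I : Type) (T : I -> topologicalType) i :
  continuous (fun f : prod_topology T => f i).
Proof.
move=> f; have /cvg_sup /(_ i) h : nbhs f --> (f : prod_topology T) by exact: cvg_id.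
move=> U nU; apply: h.
exact: (@initial_continuous _ _ (fun f : prod_topology T => f i) f U nU).
Qed.

Lemma prod_topology_continuous (Y : topologicalType) (I : Type)
    (T : I -> topologicalType) (f : Y -> prod_topology T) :
  (forall i, continuous (fun y => f y i)) -> continuous f.
Proof.
move=> cf y; apply/cvg_sup => i.
exact: (@continuous_comp_initial _ Y _ (fun g : prod_topology T => g i) f (cf i) y).
Qed.

(** * The topology of the wedge through its coordinates *)

Section WedgeTopology.
Local Open Scope quotient_scope.
Context {E : topologicalType} (P : set E) (b : vertex -> vertex -> E).
Hypothesis hb : forall t, set_bij [set s | adjb t s] P (b t).
Hypothesis hE : hausdorff_space E.
Hypothesis oP : forall p, P p -> open [set p].

Lemma mkDF_continuous (F : set vertex) t (Ft : F t) : continuous (@mkDF E F t Ft).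
Proof.
apply: continuous_comp_initial => /= e.
exact: (@existT_continuous _ (fun _ : vertex => E) t).
Qed.

Lemma side_continuous u : continuous (side b u).
Proof.
apply: (@sigT_continuous _ (fun _ : vertex => E) _
  (fun s (e : E) => if s == u then e else b u (tw u s))) => s.
by case: eqP => _ e; [exact: cvg_id|exact: cvg_cst].
Qed.

(** The choice of representative does not matter, by [side_pi]; this is what makes the coordinate
    continuous. *)
Definition coord (t : vertex) (th : wedge_prod b) : E :=
  side b t (set_val (repr (th (fs1 t)))).

Lemma coord_continuous t : continuous (coord t).
Proof.
pose g (q : finwedge b [set t]) := side b t (set_val (repr q)).
have cg : continuous g.
  apply: (@repr_comp_continuous _ _ _ (fun r : @DF E [set t] => side b t (set_val r))).
    move=> r; apply: continuous_comp; first exact: initial_continuous.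
    exact: side_continuous.
  by move=> a c /eqP e; apply/eqP/(side_pi e).
move=> th; apply: (@continuous_comp _ _ _ (fun th : wedge_prod b => th (fs1 t)) g).
  exact: prod_proj_continuous.
exact: cg.
Qed.

Lemma coord_thread x th : coherent b x -> thread x th -> forall t, coord t th = x t.
Proof.
move=> cx hth t; apply/esym/(thread_side hb cx hth) => //.
by rewrite reprK.
Qed.

(** [Y] is compact, and the amalgam is Hausdorff because continuous coordinates in [E] separate its
    points; so a continuous bijection is enough. *)
Theorem homeomorphic_dense_amalgam (Y : topologicalType) (psi : vertex -> Y -> E) :
  compact [set: Y] ->
  (forall t, continuous (psi t)) ->
  (forall y, coherent b (psi^~ y)) ->
  (forall y y', (forall t, psi t y = psi t y') -> y = y') ->
  (forall x, coherent b x -> exists y, forall t, psi t y = x t) ->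
  homeomorphic Y (set_type (@dense_amalgam_set E b)).
Proof.
move=> cY cpsi coh inj surj.
have /choice [f hf] : forall y, exists th : set_type (@dense_amalgam_set E b),
    thread (psi^~ y) (set_val th).
  move=> y; have [th hth] := thread_exists (coh y).
  by exists (SigSub (mem_set (thread_amalgam hb (coh y) hth))).
have cf (y : Y) t : coord t (set_val (f y)) = psi t y.
  exact: coord_thread (coh y) (hf y) t.
have fsurj z : exists y, f y = z.
  have [x cx hx] := amalgam_thread hb (set_valP z).
  have [y yx] := surj x cx; exists y; apply: val_inj => /=.
  have ex : psi^~ y = x by apply: funext.
  apply: (thread_uniq hb cx _ hx); rewrite -ex; exact: hf.
apply: (compact_bij_homeomorphic cY _ _ _ fsurj).
- move=> z z' zz'; have [y ey] := fsurj z; have [y' ey'] := fsurj z'.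
  rewrite -ey -ey'; congr f; apply: inj => t; rewrite -!cf ey ey'.
  pose h (w : set_type (@dense_amalgam_set E b)) := coord t (set_val w).
  have ch : continuous h.
    move=> w; apply: (@continuous_comp _ _ _ set_val).
      exact: initial_continuous.
    exact: coord_continuous.
  apply: hE => A B nA nB.
  have [w [Aw Bw]] := zz' _ _ (ch z A nA) (ch z' B nB).
  by exists (h w).
- apply: continuous_comp_initial; apply: prod_topology_continuous => F y.
  have [c [Fc [zc ec]]] := hf y F.
  pose g y' := \pi_(finwedge b (fsval F)) (@mkDF _ (fsval F) c Fc (psi c y')).
  have cg : continuous g.
    have c1 : continuous (fun y' => @mkDF _ (fsval F) c Fc (psi c y')).
      move=> y'; apply: (@continuous_comp _ _ _ (psi c)); first exact: cpsi.
      exact: mkDF_continuous.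
    move=> y'; apply: (continuous_comp (c1 y')); exact: pi_continuous.
  (* The vertex [c], central for [y], stays central for nearby points: this asks finitely many
     coordinates to keep their values, which are isolated points of [E]. *)
  have near_g : \forall y' \near y, g y' = set_val (f y') F.
    have fF : finite_set (fsval F) by case: (proj2_sig F).
    have : \forall y' \near y, forall u, fsval F u -> adjb c u -> psi u y' = b u c.
      apply: near_finite fF _ => u Fu.
      have [cu|_] := boolP (adjb c u); last by apply: nearW.
      have uc : adjb u c by rewrite adjbC.
      have ob : open [set b u c].
        by apply: oP; have [+ _ _] := hb u; apply.
      have : \forall y' \near y, [set b u c] (psi u y').
        apply: cpsi; apply: open_nbhs_nbhs; split => //=.
        by case: zc => _; apply.
      by apply: filterS.
    apply: filterS => y' hy'; apply/esym/(thread_pi hb _ (coh y') (hf y')).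
    by split.
  have gy : g y = set_val (f y) F by rewrite /g -ec.
  have := cg y; rewrite /continuous_at gy.
  by apply: cvg_trans; apply: near_eq_cvg.
- move=> y y' e; apply: inj => t; by rewrite -!cf e.
Qed.
End WedgeTopology.

Local Open Scope ring_scope.

(** * Null sequences in compact spaces *)

Lemma compact_nat_cover (T : topologicalType) (A : set T) (f : nat -> set T) :
  compact A -> (forall n, open (f n)) -> (forall x, A x -> exists n, f n x) ->
  exists N, forall x, A x -> exists2 n, (n < N)%N & f n x.
Proof.
move=> /compact_near_coveringP cA of_ cov.
have : \forall N \near \oo, A `<=` [set x | exists2 n, (n < N)%N & f n x].
  apply: (cA nat \oo (fun N x => exists2 n, (n < N)%N & f n x)) => x /cov [n fn].
  exists (f n, [set N | (n < N)%N]); last by move=> [y N] /= [fy nN]; exists n.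
  split => /=; first by apply: open_nbhs_nbhs; split.
  by exists n.+1.
by move=> [N _ hN]; exists N => x Ax; exact: (hN N (leqnn N)).
Qed.

Section Metric.
Context {R : realType}.

Lemma exists_invS_lt (e : R) : 0 < e -> exists n, n.+1%:R^-1 < e.
Proof.
by move=> e0; have [n] := @ltr_add_invr R 0 e e0; rewrite add0r; exists n.
Qed.

Lemma invS_le (m n : nat) : (m <= n)%N -> (n.+1%:R^-1 : R) <= m.+1%:R^-1.
Proof. by move=> mn; rewrite lef_pV2 ?posrE ?ler_nat. Qed.

Lemma invS_gt0 (n : nat) : 0 < (n.+1%:R^-1 : R).
Proof. by rewrite invr_gt0 ltr0n. Qed.

Lemma lebesgue_radius (T : pseudoMetricType R) (A U : set T) :
  compact A -> open U -> A `<=` U ->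
  exists2 r : R, 0 < r & forall a, A a -> ball a r `<=` U.
Proof.
move=> cA oU AU.
pose f n : set T := [set x | ball x (n.+1%:R^-1) `<=` U]°.
have [|x Ax|N hN] := @compact_nat_cover _ A f cA.
- by move=> n; exact: open_interior.
- have /nbhs_ballP [e /= e0 eU] : nbhs x U by apply: open_nbhs_nbhs; split => //; exact: AU.
  have [n ne] : exists n, (n.+1%:R^-1 : R) < e / 2 by apply: exists_invS_lt; lra.
  exists n; rewrite /f /interior; apply/nbhs_ballP; exists n.+1%:R^-1 => /=; first exact: invS_gt0.
  move=> x' xx' z x'z.
  apply: eU; apply: (le_ball _ (ball_triangle xx' x'z)).
  by move: (n.+1%:R^-1) ne => d; lra.
exists N.+1%:R^-1; first exact: invS_gt0.
move=> a /hN [n nN /interior_subset fa] z az; apply: fa.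
by apply: le_ball az; apply: invS_le; lia.
Qed.

(** The [n]-th choice reaches the finest precision 1/(m+1) attainable with [m <= n], so that one
    sequence serves every [e]. *)
Lemma near_selection (A : Type) (K : set A) (Q : nat -> A -> R -> Prop) :
  K !=set0 -> (forall n a e e', e <= e' -> Q n a e -> Q n a e') ->
  (forall e, 0 < e -> exists N, forall n, (N <= n)%N -> exists2 a, K a & Q n a e) ->
  exists2 s : nat -> A, (forall n, K (s n)) &
    forall e, 0 < e -> exists N, forall n, (N <= n)%N -> Q n (s n) e.
Proof.
move=> [a0 Ka0] mono h.
have /choice [s hs] : forall n, exists a, K a /\
    forall m, (m <= n)%N -> (exists2 a', K a' & Q n a' m.+1%:R^-1) -> Q n a m.+1%:R^-1.
  move=> n; suff : forall j, exists a, K a /\ forall m, (m <= j)%N ->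
      (exists2 a', K a' & Q n a' m.+1%:R^-1) -> Q n a m.+1%:R^-1 by exact.
  elim=> [|j [a [Ka ha]]].
    have [[a Ka Qa]|no] := pselect (exists2 a', K a' & Q n a' 0.+1%:R^-1).
      by exists a; split => // m; rewrite leqn0 => /eqP ->.
    by exists a0; split => // m; rewrite leqn0 => /eqP ->.
  have [[a' Ka' Qa']|no] := pselect (exists2 a', K a' & Q n a' j.+2%:R^-1).
    by exists a'; split => // m mj _; apply: mono Qa'; exact: invS_le.
  exists a; split => // m; rewrite leq_eqVlt => /orP [/eqP ->//|]; exact: ha.
exists s; first by move=> n; case: (hs n).
move=> e e0; have [m me] := exists_invS_lt e0.
have [N hN] := h _ (invS_gt0 m).
exists (maxn N m) => n; rewrite geq_max => /andP [Nn mn].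
apply: mono (ltW me) _; have [_ +] := hs n; apply => //; exact: hN.
Qed.

Lemma injective_tendsto (f : nat -> nat) : injective f ->
  forall M, exists N, forall n, (N <= n)%N -> (M <= f n)%N.
Proof.
move=> fi; elim=> [|M [N hN]]; first by exists 0%N.
have [[m fm]|no] := pselect (exists m, f m = M).
  exists (maxn N m.+1) => n; rewrite geq_max => /andP [Nn mn].
  rewrite ltn_neqAle hN // andbT; apply/eqP => e.
  by have := fi m n; rewrite fm => /(_ e); lia.
exists N => n Nn; rewrite ltn_neqAle hN // andbT; apply/eqP => e.
by apply: no; exists n.
Qed.

Lemma injective_choice (Q : nat -> nat -> Prop) :
  (forall n N, exists2 m, (N <= m)%N & Q n m) ->
  exists2 f : nat -> nat, injective f & forall n, Q n (f n).
Proof.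
move=> h; have /choice [g hg] : forall nN : nat * nat,
    exists m, (nN.2 <= m)%N /\ Q nN.1 m.
  by move=> [n N]; have [m Nm Qm] := h n N; exists m.
pose f := fix f n := if n is n'.+1 then g (n, (f n').+1) else g (0%N, 0%N).
have fS n : (f n < f n.+1)%N by case: (hg (n.+1, (f n).+1)).
exists f; last first.
  by case=> [|n]; [case: (hg (0%N, 0%N))|case: (hg (n.+1, (f n).+1))].
have mono m n : (m < n)%N -> (f m < f n)%N.
  elim: n => // n IH; rewrite ltnS leq_eqVlt => /orP [/eqP -> //|/IH mn].
  exact: ltn_trans mn (fS n).
move=> m n e; case: (ltngtP m n) => // /mono; rewrite e ltnn //.
Qed.

Lemma banach_bijection (f g : nat -> nat) : injective f -> injective g ->
  exists s t : nat -> nat, [/\ cancel s t, cancel t s &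
    forall n, s n = f n \/ g (s n) = n].
Proof.
move=> fi gi.
(* The points whose backward orbit stops outside the range of [g]; the bijection is [f] on [A] and
   the inverse of [g] elsewhere. *)
pose A : set nat := fun n => exists j m, n = iter j (g \o f) m /\ ~ exists q, g q = m.
have Ag n : ~ A n -> exists q, g q = n.
  by move=> nA; apply: contrapT => nq; apply: nA; exists 0%N, n.
have hs n : exists m, (A n /\ m = f n) \/ (~ A n /\ g m = n).
  have [An|nA] := pselect (A n); first by exists (f n); left.
  by have [q gq] := Ag _ nA; exists q; right.
have [s {}hs] := choice hs.
have ht m : exists n, s n = m.
  have [Agm|nA] := pselect (A (g m)); last first.
    by exists (g m); case: (hs (g m)) => [[]//|[_ /gi]].
  case: Agm => -[|j] [q [e nq]]; first by case: nq; exists m.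
  rewrite /= in e; move/gi: e => e; exists (iter j (g \o f) q).
  case: (hs (iter j (g \o f) q)) => [[_ ->]//|[nA _]].
  by case: nA; exists j, q.
have [t tK] := choice ht.
have si : injective s.
  move=> n n' e; case: (hs n) => [[An sn]|[nA gn]]; case: (hs n') => [[An' sn']|[nA' gn']].
  - by apply: fi; rewrite -sn -sn'.
  - exfalso; apply: nA'; case: An => j [q [en nq]]; exists j.+1, q; split => //.
    by rewrite /= -en -sn e gn'.
  - exfalso; apply: nA; case: An' => j [q [en nq]]; exists j.+1, q; split => //.
    by rewrite /= -en -sn' -e gn.
  - by rewrite -gn -gn' e.
exists s, t; split => // [n|n]; first by apply: si; rewrite tK.
by case: (hs n) => [[_ ->]|[_]]; [left|right].
Qed.

(* Each of the two injections moves the n-th term of its source by at most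
1/(n+1), and the bijection combined from them tends to infinity. *)
Lemma matching (T : pseudoMetricType R) (S : set T) (al be : nat -> T) :
  (forall n, S (al n)) -> (forall n, S (be n)) ->
  (forall x (e : R) N, S x -> 0 < e -> exists2 n, (N <= n)%N & ball x e (al n)) ->
  (forall x (e : R) N, S x -> 0 < e -> exists2 n, (N <= n)%N & ball x e (be n)) ->
  exists s t : nat -> nat, [/\ cancel s t, cancel t s &
    forall e : R, 0 < e -> exists N, forall n, (N <= n)%N -> ball (al n) e (be (s n))].
Proof.
move=> Sal Sbe aal abe.
have [f fi hf] := @injective_choice (fun n m => ball (al n) (n.+1%:R^-1) (be m))
  (fun n N => abe _ _ N (Sal n) (invS_gt0 n)).
have [g gi hg] := @injective_choice (fun n m => ball (be n) (n.+1%:R^-1) (al m))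
  (fun n N => aal _ _ N (Sbe n) (invS_gt0 n)).
have [s [t [sK tK hs]]] := banach_bijection fi gi.
exists s, t; split => // e e0; have [m me] := exists_invS_lt e0.
have [N hN] := injective_tendsto (can_inj sK) m.
exists (maxn N m) => n; rewrite geq_max => /andP [Nn mn].
case: (hs n) => [->|gs].
  by apply: le_ball (hf n); apply: le_trans (invS_le mn) (ltW me).
apply: ball_sym; rewrite -{2}gs; apply: le_ball (hg (s n)).
by apply: le_trans (ltW me); apply: invS_le; exact: hN.
Qed.
End Metric.

(** * Convergence and accumulation of the peripheral points *)

Section PeripheralPoints.
Context {R : realType} {E : pseudoMetricType R} (P : set E).
Hypothesis hE : hausdorff_space E.
Hypothesis cE : compact [set: E].
Hypothesis P_open1 : forall p, P p -> open [set p].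
Hypothesis P_dense : dense P.
(** At a vertex, [be] will list the points of the edges to its children and [o] will be that of the
    edge to its parent; at the root [o] repeats a value of [be]. *)
Variables (be : nat -> E) (o : E).
Hypothesis be_inj : injective be.
Hypothesis be_P : forall n, P (be n).
Hypothesis o_P : P o.
Hypothesis be_all : forall p, P p -> p = o \/ exists n, be n = p.

(** Outside a neighbourhood of the nonperipheral set there remains a compact set of isolated points,
    hence a finite one. *)
Lemma periph_null (e : R) : 0 < e ->
  exists N, forall n, (N <= n)%N -> exists2 q, (~` P) q & ball q e (be n).
Proof.
move=> e0; pose L := ~` \bigcup_(q in ~` P) (ball q e)°.
have clL : closed L by apply: open_closedC; apply: bigcup_open => a _; exact: open_interior.
pose f n : set E := if n is n'.+1 then [set be n'] else [set o].
have [|||N hN] := @compact_nat_cover E L f.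
- exact: subclosed_compact clL cE _.
- by case=> [|n]; apply: P_open1.
- move=> x Lx; have Px : P x.
    by apply: contrapT => nPx; apply: Lx; exists x => //; exact: nbhsx_ballx.
  by have [->|[n <-]] := be_all Px; [exists 0%N|exists n.+1].
have [M hM] : exists M, forall n, (M <= n)%N -> be n <> o.
  have [[m em]|no] := pselect (exists m, be m = o).
    by exists m.+1 => n mn en; have := @be_inj m n; rewrite em en => /(_ erefl); lia.
  by exists 0%N => n _ en; apply: no; exists n.
exists (maxn N M) => n; rewrite geq_max => /andP [Nn Mn].
have [Lb|nLb] := pselect (L (be n)).
  have [[|m] mN /= em] := hN _ Lb; first by case: (hM n Mn).
  by have := be_inj em; lia.
have [q nPq /interior_subset qb] : (\bigcup_(q in ~` P) (ball q e)°) (be n).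
  by apply: contrapT => h; exact: nLb.
by exists q.
Qed.

(** Removing finitely many peripheral points from the ball leaves a neighbourhood of [x], in which
    density of [P] yields another one. *)
Lemma periph_acc x (e : R) N : (~` P) x -> 0 < e ->
  exists2 n, (N <= n)%N & ball x e (be n).
Proof.
move=> nPx e0; pose B := \bigcup_(m in `I_N.+1) [set if m is m'.+1 then be m' else o].
have clB : closed B.
  apply: closed_bigcup => [|m _]; first exact: finite_II.
  exact/accessible_closed_set1/hausdorff_accessible.
have [||p [[/interior_subset xp nBp] Pp]] := @P_dense ((ball x e)° `&` ~` B).
- exists x; split; first exact: nbhsx_ballx.
  by move=> [[|m] _ /= ex]; apply: nPx; rewrite ex.
- by apply: openI; [exact: open_interior|exact: closed_openC].
have [po|[n en]] := be_all Pp.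
  by case: nBp; exists 0%N.
exists n; last by rewrite en.
by rewrite leqNgt; apply/negP => nN; apply: nBp; exists n.+1.
Qed.
End PeripheralPoints.

(** * The core inside the peripheral extension *)

Section CoreMap.
Context {k : nat} {Y E : topologicalType} {X : 'I_k -> topologicalType}.
Variables (P : set E) (Zs : 'I_k -> set Y) (e0 : E).
Hypothesis Zs_closed : forall i, closed (Zs i).
Hypothesis Zs_disj : forall i j y, Zs i y -> Zs j y -> i = j.
Hypothesis Zs_homeo : forall i, homeomorphic (set_type (Zs i)) (X i).
Hypothesis P_homeo : homeomorphic (set_type (~` P)) {i : 'I_k & X i}.

(** A homeomorphism of the core onto the nonperipheral part, extended by the constant [e0]; hence
    continuity is claimed only along the core. *)
Lemma core_map : exists Phi : Y -> E,
  [/\ forall i y, Zs i y -> ~ P (Phi y),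
      forall i i' y y', Zs i y -> Zs i' y' -> Phi y = Phi y' -> y = y',
      forall q, ~ P q -> exists i y, Zs i y /\ Phi y = q &
      forall i x (U : set E), Zs i x -> nbhs (Phi x) U ->
        \forall y \near x, (exists j, Zs j y) -> U (Phi y)].
Proof.
have [u [v [uK vK cu cv]]] := P_homeo.
pose h i := projT1 (cid (Zs_homeo i)).
pose g i := projT1 (cid (projT2 (cid (Zs_homeo i)))).
have hg i : [/\ cancel (h i) (g i), cancel (g i) (h i), continuous (h i) & continuous (g i)].
  exact: (projT2 (cid (projT2 (cid (Zs_homeo i))))).
pose F i (z : set_type (Zs i)) : E := set_val (v (existT _ i (h i z))).
have cF i : continuous (F i).
  move=> z; apply: (@continuous_comp _ _ _ (fun z => v (existT _ i (h i z))) set_val).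
    apply: (@continuous_comp _ _ _ (fun z => existT _ i (h i z)) v); last exact: cv.
    apply: (@continuous_comp _ _ _ (h i) (existT X i)); last exact: existT_continuous.
    by have [_ _ ch _] := hg i; exact: ch.
  exact: initial_continuous.
have /choice [Phi hPhi] : forall y, exists e, forall i (zy : Zs i y),
    e = F i (SigSub (mem_set zy)).
  move=> y; have [[i zy]|no] := pselect (exists i, Zs i y); last first.
    by exists e0 => i zy; case: no; exists i.
  exists (F i (SigSub (mem_set zy))) => j zy'.
  have ij := Zs_disj zy zy'; subst j; congr (F i _); exact: val_inj.
exists Phi; split.
- by move=> i y zy; rewrite (hPhi y i zy); exact: (set_valP (v _)).
- move=> i i' y y' zy zy'; rewrite (hPhi y i zy) (hPhi y' i' zy') => /val_inj.
  move=> /(can_inj vK) /(congr1 (fun s : {i : 'I_k & X i} => set_val (g (projT1 s) (projT2 s)))).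
  by rewrite /=; have [-> _ _ _] := hg i; have [-> _ _ _] := hg i'.
- move=> q nPq; pose s := u (SigSub (mem_set (nPq : (~` P) q))).
  have zy := set_valP (g (projT1 s) (projT2 s)).
  exists (projT1 s), (set_val (g (projT1 s) (projT2 s))); split => //.
  rewrite (hPhi _ _ zy) /F (_ : SigSub _ = g (projT1 s) (projT2 s)); last exact: val_inj.
  have [_ -> _ _] := hg (projT1 s); rewrite (_ : existT _ _ _ = s); last by case: (s).
  by rewrite uK.
- move=> i x U zx; rewrite (hPhi x i zx) => nU.
  have [B [[W oW <-] Wx] BA] := cF i (SigSub (mem_set zx)) U nU.
  (* The other pieces form a closed set missing [x], so near [x] the core is [Zs i] alone. *)
  pose C := \bigcup_(j in [set j | j != i]) Zs j.
  have clC : closed C.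
    by apply: closed_bigcup => [|j _]; [exact: finite_finset|exact: Zs_closed].
  have : \forall y \near x, (W `&` ~` C) y.
    apply: open_nbhs_nbhs; split; first by apply: openI => //; exact: closed_openC.
    split => // -[j /= ji zj]; by rewrite (Zs_disj zj zx) eqxx in ji.
  apply: filterS => y [Wy nCy] [j zj]; have [ji|ji] := eqVneq j i.
    by subst j; rewrite (hPhi y i zj); exact: BA.
  by case: nCy; exists j.
Qed.
End CoreMap.

(** * Children of a region *)

Section Decomposition.
Context {R : realType} {k : nat} {Y : pseudoMetricType R}.
Variable Ys : 'I_k -> set (set Y).
Hypothesis hk : (0 < k)%N.
Hypothesis hYh : hausdorff_space Y.
Hypothesis hYc : compact [set: Y].
Hypothesis Ys_disj : forall p q : 'I_k * set Y, Ys p.1 p.2 -> Ys q.1 q.2 -> p <> q ->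
      p.2 `&` q.2 = set0.
Hypothesis Ys_closed : forall i Z, Ys i Z -> closed Z.
Hypothesis Ys_neq0 : forall i Z, Ys i Z -> Z !=set0.
Hypothesis Ys_null : forall e : R, 0 < e ->
      finite_set [set p : 'I_k * set Y | Ys p.1 p.2 /\
        exists x y, [/\ p.2 x, p.2 y & ~ ball x e y]].
Hypothesis Ys_boundary : forall i (Z : set Y), Ys i Z -> dense (~` Z).
Hypothesis Ys_dense : forall i, dense (\bigcup_(Z in Ys i) Z).
Hypothesis Ys_sep : forall x y : Y, x <> y ->
      ~ (exists i (Z : set Y), [/\ Ys i Z, Z x & Z y]) ->
      exists H : set Y, [/\ clopen H,
        (forall i (Z : set Y), Ys i Z -> Z `<=` H \/ Z `&` H = set0),
        H x & ~ H y].
Variable idx : 'I_k * set Y -> nat.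

(** Its classes are the points of the quotient that collapses every member. *)
Definition same (y z : Y) := y = z \/ exists i Z, [/\ Ys i Z, Z y & Z z].

Definition csat (H : set Y) := clopen H /\ forall y z, same y z -> H y -> H z.

Lemma csat_sub H i Z y : csat H -> Ys i Z -> Z y -> H y -> Z `<=` H.
Proof. by move=> [_ sH] YZ Zy Hy z Zz; apply: sH Hy; right; exists i, Z. Qed.

Lemma Ys_eq i i' Z Z' y : Ys i Z -> Ys i' Z' -> Z y -> Z' y -> (i, Z) = (i', Z').
Proof.
move=> YZ YZ' Zy Zy'; apply: contrapT => ne.
have e := Ys_disj (p := (i, Z)) (q := (i', Z')) YZ YZ' ne.
by have : (Z `&` Z') y by []; rewrite e.
Qed.

Lemma same_sym y z : same y z -> same z y.
Proof. by case=> [->|[i [Z [? ? ?]]]]; [left|right; exists i, Z]. Qed.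

Lemma same_closed y : closed [set z | same y z].
Proof.
have [[i [Z [YZ Zy]]]|no] := pselect (exists i Z, Ys i Z /\ Z y).
  rewrite (_ : mkset _ = Z); first exact: Ys_closed YZ.
  apply/seteqP; split => [z [<- //|[i' [Z' [YZ' Zy' Zz']]]]|z Zz].
    by have [_ ->] := Ys_eq YZ YZ' Zy Zy'.
  by right; exists i, Z.
rewrite (_ : mkset _ = [set y]).
  exact/accessible_closed_set1/hausdorff_accessible.
apply/seteqP; split => [z [<- //|[i [Z [YZ Zy _]]]]|z ->]; last by left.
by case: no; exists i, Z.
Qed.

Lemma csat_setT : csat setT.
Proof. by split => //; exact: clopenT. Qed.

Lemma csat_setI H H' : csat H -> csat H' -> csat (H `&` H').
Proof.
move=> [cH sH] [cH' sH']; split; first exact: clopenI.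
by move=> y z yz [Hy H'y]; split; [exact: sH Hy|exact: sH' H'y].
Qed.

Lemma csat_setC H : csat H -> csat (~` H).
Proof.
move=> [cH sH]; split; first exact: clopenC.
by move=> y z yz nHy Hz; apply: nHy; apply: sH Hz; exact: same_sym.
Qed.

Lemma csat_separate y z : ~ same y z -> exists H, [/\ csat H, H y & ~ H z].
Proof.
move=> nyz; have yz : y <> z by move=> e; apply: nyz; left.
have [|H [cH sH Hy nHz]] := Ys_sep yz.
  by move=> h; apply: nyz; right.
exists H; split => //; split => // u v [<- //|[i [Z [YZ Zu Zv]]]] Hu.
have [ZH|ZH] := sH i Z YZ; first exact: ZH.
by have : (Z `&` H) u by []; rewrite ZH.
Qed.

Lemma csat_enumeration (y0 : Y) : exists W : nat -> set Y,
  (forall n, csat (W n)) /\ forall H, csat H -> exists n, W n = H.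
Proof.
pose Yp : pseudoPMetricType R := HB.pack (PseudoMetric.sort Y)
  (PseudoMetric.class Y) (isPointed.Build (PseudoMetric.sort Y) y0).
have [f] := @clopen_surj R Yp hYc.
have /choice [W hW] : forall n, exists H : set Y, csat H /\ (csat (f n) -> H = f n).
  move=> n; have [cf|ncf] := pselect (csat (f n)); first by exists (f n).
  by exists setT; split => //; exact: csat_setT.
exists W; split => [n|H cH]; first by case: (hW n).
have [n _ fn] := 'surj_f cH.1.
by exists n; case: (hW n) => _ ->; rewrite fn.
Qed.

Section Atoms.
Variable W : nat -> set Y.
Hypothesis W_csat : forall n, csat (W n).
Hypothesis W_all : forall H, csat H -> exists n, W n = H.

(** Cells of the partition generated by an initial segment of the enumeration; any two atoms are
    nested or disjoint. *)
Definition atom (j : nat) (y : Y) : set Y :=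
  [set z | forall i, (i < j)%N -> (W i y <-> W i z)].

Lemma atom_le i j y : (i <= j)%N -> atom j y `<=` atom i y.
Proof. by move=> ij z h l li; apply: h; apply: leq_trans ij. Qed.

Lemma atom_eq j y z : atom j y z -> atom j y = atom j z.
Proof.
move=> h; apply/seteqP; split => w hw i ij.
  by rewrite -(h i ij); exact: hw.
by rewrite (h i ij); exact: hw.
Qed.

Lemma atom_csat j y : csat (atom j y).
Proof.
elim: j => [|j IH].
  rewrite (_ : atom 0 y = setT); first exact: csat_setT.
  by apply/seteqP; split.
have [Wy|nWy] := pselect (W j y).
  rewrite (_ : atom j.+1 y = atom j y `&` W j); first exact: csat_setI.
  apply/seteqP; split => [z h|z [h Wz] i].
    by split; [apply: atom_le h|rewrite -(h j)].
  by rewrite ltnS leq_eqVlt => /orP [/eqP ->//|]; exact: h.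
rewrite (_ : atom j.+1 y = atom j y `&` ~` W j).
  by apply: csat_setI => //; exact: csat_setC.
apply/seteqP; split => [z h|z [h Wz] i].
  by split; [apply: atom_le h|move=> Wz; apply: nWy; rewrite (h j)].
by rewrite ltnS leq_eqVlt => /orP [/eqP ->//|]; exact: h.
Qed.

Lemma atom_same y z : (forall j, atom j y z) -> same y z.
Proof.
move=> h; apply: contrapT => /csat_separate [H [/W_all [n <-] Wy nWz]].
by apply: nWz; rewrite -(h n.+1 n).
Qed.

(** By compactness, since the atoms of [y] decrease to its class. *)
Lemma atom_small y (U : set Y) : open U -> [set z | same y z] `<=` U ->
  exists j, atom j y `<=` U.
Proof.
move=> oU yU.
have [|||N hN] := @compact_nat_cover _ (~` U) (fun j => ~` atom j y).
- by apply: subclosed_compact hYc _ => //; exact: open_closedC.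
- by move=> j; apply: closed_openC; case: (atom_csat j y) => -[].
- move=> z nUz; apply: contrapT => no; apply: nUz; apply: yU; apply: atom_same => j.
  by apply: contrapT => nj; apply: no; exists j.
exists N => z az; apply: contrapT => /hN [n nN]; apply.
by apply: atom_le az; exact: ltnW.
Qed.

Section Children.
Variables (H : set Y) (Zs : 'I_k -> set Y).
Hypothesis cH : csat H.
Hypothesis ZsY : forall i, Ys i (Zs i).
Hypothesis ZsH : forall i, Zs i `<=` H.

Let K := [set y | exists i, Zs i y].

Lemma core_closed : closed K.
Proof.
rewrite (_ : K = \bigcup_(i in [set: 'I_k]) Zs i).
  by apply: closed_bigcup => [|i _]; [exact: finite_finset|exact: Ys_closed (ZsY i)].
by apply/seteqP; split => [y [i Zy]|y [i _ Zy]]; exists i.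
Qed.

Lemma core_same y z : same y z -> K y -> K z.
Proof.
case=> [->//|[i [Z [YZ Zy Zz]]]] [i' Zy'].
by exists i'; have [_ <-] := Ys_eq YZ (ZsY i') Zy Zy'.
Qed.

(* [D] is close to a single [same]-class at the scale of its distance to the
core; as only finitely many classes are large, the good sets near the core are small. *)
Definition good (D : set Y) := D `<=` H /\ exists2 r : R, 0 < r &
  (forall a c, K a -> D c -> ~ ball a r c) /\
  exists x, D x /\ forall c, D c -> exists m, same x m /\ ball m r c.

(** The class of [y] is compact and misses the core, so its [r]-balls miss the core for some [r]; an
    atom inside the [r / 2]-neighbourhood of the class is good with radius [r / 2]. *)
Lemma good_exists y : H y -> ~ K y -> exists j, good (atom j y).
Proof.
move=> Hy nKy; have cM := @same_closed y.
have [|||r r0 hr] := @lebesgue_radius R Y [set z | same y z] (~` K).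
- exact: subclosed_compact cM hYc _.
- exact/closed_openC/core_closed.
- by move=> z yz Kz; apply: nKy; apply: core_same Kz; exact: same_sym.
have r20 : 0 < r / 2 by lra.
pose V := (\bigcup_(m in [set z | same y z]) (ball m (r / 2))°) `&` H.
have [||j hj] := @atom_small y V.
- apply: openI; last by case: cH => -[].
  by apply: bigcup_open => m _; exact: open_interior.
- move=> z yz; split; last by case: cH => _; apply; last exact: Hy.
  exists z => //; rewrite /interior; exact: nbhsx_ballx.
exists j; split; first by move=> z /hj [].
exists (r / 2) => //; split.
  move=> a c Ka /hj [[m ym /interior_subset mc] _] ac.
  have mb : ball m r a.
    rewrite [r]splitr; apply: ball_triangle mc _; exact: ball_sym.
  exact: (hr m ym _ mb).
exists y; split => // c /hj [[m ym /interior_subset mc] _].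
by exists m.
Qed.

(** The first good atom around a point off the core; minimality of [j] makes two children equal or
    disjoint. *)
Definition child (D : set Y) := exists y, [/\ H y, ~ K y &
  exists j, [/\ D = atom j y, good D & forall i, (i < j)%N -> ~ good (atom i y)]].

Lemma child_cover y : H y -> ~ K y -> exists2 D, child D & D y.
Proof.
move=> Hy nKy; have [j0 gj0] := good_exists Hy nKy.
have ex : exists j, `[< good (atom j y) >] by exists j0; apply/asboolP.
exists (atom (ex_minn ex) y) => //; exists y; split => //.
exists (ex_minn ex); case: ex_minnP => j /asboolP gj mj; split => // i ij gi.
by have /mj := introT (asboolP _) gi; lia.
Qed.

Lemma child_disj D D' y : child D -> child D' -> D y -> D' y -> D = D'.
Proof.
move=> [u [_ _ [j [-> gj mj]]]] [v [_ _ [j' [-> gj' mj']]]] Dy D'y.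
rewrite (atom_eq Dy) (atom_eq D'y).
have hj i : (i <= j)%N -> atom i u = atom i y by move=> ij; exact/atom_eq/(atom_le ij).
have hj' i : (i <= j')%N -> atom i v = atom i y by move=> ij; exact/atom_eq/(atom_le ij).
case: (ltngtP j j') => [lt|lt|-> //].
  by have := mj' _ lt; rewrite hj' 1?ltnW // -(atom_eq Dy).
by have := mj _ lt; rewrite hj 1?ltnW // -(atom_eq D'y).
Qed.

Lemma child_csat D : child D -> csat D.
Proof. by move=> [u [_ _ [j [-> _ _]]]]; exact: atom_csat. Qed.

Lemma child_neq0 D : child D -> D !=set0.
Proof. by move=> [u [_ _ [j [-> _ _]]]]; exists u. Qed.

Lemma child_notcore D y : child D -> D y -> ~ K y.
Proof.
move=> [_ [_ _ [_ [_ [_ [r r0 [far _]]] _]]]] Dy Ky.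
by apply: (far y y) => //; exact: ballxx.
Qed.

Lemma child_sub D : child D -> D `<=` H.
Proof. by move=> [_ [_ _ [_ [_ [+ _] _]]]]. Qed.

Lemma child_atom D y : child D -> D y -> exists j, D = atom j y.
Proof. by move=> [u [_ _ [j [-> _ _]]]] Dy; exists j; exact: atom_eq. Qed.

(** Near [x] there is a point of [H] off the core and off the finitely many closed children in [A];
    the child around it is new. *)
Lemma child_acc x (U : set Y) (A : set (set Y)) : K x -> open U -> U x ->
  finite_set A -> A `<=` child -> exists D, [/\ child D, ~ A D & exists2 c, D c & U c].
Proof.
move=> [i Zx] oU Ux fA AC.
(* Density of the complement is applied only to the piece containing [x]; the other pieces are
   avoided as a closed set. *)
pose B := \bigcup_(D in A) D; pose C := \bigcup_(j in [set j | j != i]) Zs j.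
have clB : closed B.
  by apply: closed_bigcup => // D /AC /child_csat [[]].
have clC : closed C.
  by apply: closed_bigcup => [|j _]; [exact: finite_finset|exact: Ys_closed (ZsY j)].
have [||c [[[Hc Uc] [nBc nCc]] nZc]] :=
    @Ys_boundary i (Zs i) (ZsY i) ((H `&` U) `&` (~` B `&` ~` C)).
- exists x; split; [split => //; exact: ZsH Zx|split].
    by move=> [D /AC cD Dx]; apply: (child_notcore cD Dx); exists i.
  by move=> [j /= ji Zjx]; have [ij _] := Ys_eq (ZsY j) (ZsY i) Zjx Zx; rewrite ij eqxx in ji.
- apply: openI; first by apply: openI => //; case: cH => -[].
  by apply: openI; exact: closed_openC.
have nKc : ~ K c.
  move=> [j Zjc]; have [e|ne] := eqVneq j i; first by apply: nZc; rewrite -e.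
  by apply: nCc; exists j.
have [D cD Dc] := child_cover Hc nKc; exists D; split => //; last by exists c.
by move=> AD; apply: nBc; exists D.
Qed.

(** Countable because children occur in [W]; infinite because [child_acc] produces a child outside
    any finite set of them. *)
Lemma child_enumeration : exists e : nat -> set Y,
  set_bij [set: nat] child e.
Proof.
suff : (child #= [set: nat])%card by rewrite card_eq_sym => /card_set_bijP.
rewrite card_eq_le; apply/andP; split.
  apply: (@card_le_trans _ _ _ (W @` [set: nat])); last exact: card_image_le.
  by apply: subset_card_le => D /child_csat /W_all [n <-]; exists n.
apply/infiniteP => fin.
have [x Zx] := Ys_neq0 (ZsY (Ordinal hk)).
have Kx : K x by exists (Ordinal hk).
by have [D [cD]] := child_acc Kx openT I fin (@subset_refl _ _).
Qed.

(** Finitely many children reach away from the core, by compactness, and finitely many contain a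
    large member, by nullity; any other child is close to the core, and goodness makes it small. *)
Lemma child_null (e : nat -> set Y) : set_bij [set: nat] child e ->
  forall eps : R, 0 < eps -> exists N, forall n, (N <= n)%N ->
    exists2 a, K a & forall c, e n c -> ball a eps c.
Proof.
move=> [eC einj eS] eps eps0.
have ech n : child (e n) by exact: eC.
have ein m n y : e m y -> e n y -> m = n.
  by move=> my ny; apply: einj; rewrite ?inE //; exact: child_disj my ny.
(* Two steps of at most [d] and two of at most [r <= d] lead from [a] to any point of the child. *)
pose d := eps / 4; have d0 : 0 < d by rewrite /d; lra.
pose L := ~` \bigcup_(a in K) (ball a d)°.
have clL : closed L.
  by apply: open_closedC; apply: bigcup_open => a _; exact: open_interior.
have [|||N1 hN1] := @compact_nat_cover Y (L `&` H) e.
- apply: subclosed_compact hYc _ => //; apply: closedI => //.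
  by case: cH => -[].
- by move=> n; case: (child_csat (ech n)) => -[].
- move=> y [Ly Hy]; have [|D cD Dy] := child_cover Hy.
    by move=> Ky; apply: Ly; exists y => //; exact: nbhsx_ballx.
  by have [n _ en] := eS D cD; exists n; rewrite en.
have : \forall n \near \oo, forall p : 'I_k * set Y, (Ys p.1 p.2 /\
        exists x y, [/\ p.2 x, p.2 y & ~ ball x d y]) -> ~ p.2 `<=` e n.
  apply: near_finite (Ys_null d0) _ => -[i Z] /= [YZ _].
  have [z Zz] := Ys_neq0 YZ.
  have [[m em]|no] := pselect (exists m, e m z).
    exists m.+1 => // n /= mn Zn; have := ein _ _ _ em (Zn z Zz); lia.
  by apply: nearW => n Zn; apply: no; exists n; exact: Zn.
move=> [N2 _ hN2]; exists (maxn N1 N2) => n; rewrite geq_max => /andP [N1n N2n].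
have [_ [_ _ [_ [_ [eH [r r0 [far [x [ex hx]]]]] _]]]] := ech n.
have [[c0 [ec0 nLc0]]|no] := pselect (exists c0, e n c0 /\ ~ L c0); last first.
  have [|m mN em] := hN1 x; last by have := ein _ _ _ em ex; lia.
  by split; [apply: contrapT => nL; apply: no; exists x|exact: eH].
have [a Ka /interior_subset ac0] : (\bigcup_(a in K) (ball a d)°) c0.
  by apply: contrapT => h; exact: nLc0.
(* The point [c0] of the child is within [d] of the core, while goodness excludes distances below
   [r]. *)
have rd : r <= d.
  by rewrite leNgt; apply/negP => /ltW dr; apply: (far a c0) => //; exact: le_ball ac0.
have xm m m' : same x m -> same x m' -> ball m d m'.
  case=> [<-|[i [Z [YZ Zx Zm]]]]; case=> [<-|[i' [Z' [YZ' Zx' Zm']]]].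
  - exact: ballxx.
  - apply: contrapT => nb; apply: (hN2 n N2n (i', Z')).
      by split => //; exists x, m'.
    exact: csat_sub (child_csat (ech n)) YZ' Zx' ex.
  - apply: contrapT => nb; apply: (hN2 n N2n (i, Z)).
      by split => //; exists m, x.
    exact: csat_sub (child_csat (ech n)) YZ Zx ex.
  - have [_ eZ] := Ys_eq YZ YZ' Zx Zx'; rewrite -eZ in Zm'.
    apply: contrapT => nb; apply: (hN2 n N2n (i, Z)).
      by split => //; exists m, m'.
    exact: csat_sub (child_csat (ech n)) YZ Zx ex.
exists a => // c ec.
have [m0 [xm0 m0c0]] := hx c0 ec0; have [m [xm1 mc]] := hx c ec.
have b1 := ball_triangle ac0 (ball_sym m0c0).
have b2 := ball_triangle b1 (xm _ _ xm0 xm1).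
have b3 := ball_triangle b2 mc.
by apply: le_ball b3; rewrite /d in rd *; lra.
Qed.

Lemma child_near (e : nat -> set Y) : set_bij [set: nat] child e ->
  forall x (eps : R) N, K x -> 0 < eps ->
    exists2 n, (N <= n)%N & exists2 c, e n c & ball x eps c.
Proof.
move=> [eC einj eS] x eps N Kx eps0.
have [||||D [cD nD [c Dc /interior_subset xc]]] :=
  @child_acc x (ball x eps)° (e @` `I_N) Kx.
- exact: open_interior.
- exact: nbhsx_ballx.
- by apply: finite_image; exact: finite_II.
- by move=> _ [n _ <-]; exact: eC.
have [n _ en] := eS D cD; exists n; last by exists c; rewrite ?en.
by rewrite leqNgt; apply/negP => nN; apply: nD; exists n.
Qed.

End Children.
End Atoms.

(** * A region as a peripheral extension of its core *)

Section Step.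
Context {E : pseudoMetricType R} {X : 'I_k -> topologicalType} (P : set E).
Hypothesis hE : hausdorff_space E.
Hypothesis cE : compact [set: E].
Hypothesis P_open1 : forall p, P p -> open [set p].
Hypothesis P_dense : dense P.
Hypothesis Ys_homeo : forall i Z, Ys i Z -> homeomorphic (set_type Z) (X i).
Hypothesis P_homeo : homeomorphic (set_type (~` P)) {i : 'I_k & X i}.
Variable W : nat -> set Y.
Hypothesis W_csat : forall n, csat (W n).
Hypothesis W_all : forall H, csat H -> exists n, W n = H.

Lemma least_members H : csat H -> H !=set0 -> exists Zs : 'I_k -> set Y,
  forall i, [/\ Ys i (Zs i), Zs i `<=` H &
    forall Z, Ys i Z -> Z `<=` H -> (idx (i, Zs i) <= idx (i, Z))%N].
Proof.
move=> cH H0; suff /choice [Zs hZs] : forall i, exists Zi, [/\ Ys i Zi, Zi `<=` H &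
    forall Z, Ys i Z -> Z `<=` H -> (idx (i, Zi) <= idx (i, Z))%N] by exists Zs.
move=> i.
have ex : exists n, `[< exists Z, [/\ Ys i Z, Z `<=` H & idx (i, Z) = n] >].
  have [|y [Hy [Z YZ Zy]]] := @Ys_dense i H H0; first by case: cH => -[].
  exists (idx (i, Z)); apply/asboolP; exists Z; split => //.
  exact: csat_sub cH YZ Zy Hy.
case: (ex_minnP ex) => m /asboolP [Z [YZ ZH Zm]] hm.
exists Z; split => // Z' YZ' Z'H; rewrite Zm; apply: hm.
by apply/asboolP; exists Z'.
Qed.

(** [psi] presents [H], with each [D n] collapsed, as a peripheral extension of the core;
    [step_least] and [step_atom] control infinite descents in the tree. *)
Record step_spec (H : set Y) (be : nat -> E) (D : nat -> set Y)
    (Zs : 'I_k -> set Y) (psi : Y -> E) : Prop := StepSpec {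
  step_mem : forall i, Ys i (Zs i);
  step_memH : forall i, Zs i `<=` H;
  step_least : forall i Z, Ys i Z -> Z `<=` H -> (idx (i, Zs i) <= idx (i, Z))%N;
  step_csat : forall n, csat (D n);
  step_neq0 : forall n, D n !=set0;
  step_sub : forall n, D n `<=` H;
  step_ncore : forall n y i, D n y -> ~ Zs i y;
  step_atom : forall n y, D n y -> exists j, D n = atom W j y;
  step_cover : forall y, H y -> (exists i, Zs i y) \/ exists n, D n y;
  step_D : forall n y, D n y -> psi y = be n;
  step_nP : forall i y, Zs i y -> ~ P (psi y);
  step_inj : forall i i' y y', Zs i y -> Zs i' y' -> psi y = psi y' -> y = y';
  step_surj : forall q, ~ P q -> exists i y, Zs i y /\ psi y = q;
  step_cont : forall y, H y -> {for y, continuous psi} }.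

(** The children converge to the core and the points [be n] to the nonperipheral part, both
    accumulating everywhere on their limit sets; so they can be paired with vanishing error, which
    gives continuity at the core. *)
Lemma step_exists H (be : nat -> E) o : csat H -> H !=set0 -> injective be ->
  (forall n, P (be n)) -> P o -> (forall p, P p -> p = o \/ exists n, be n = p) ->
  exists D Zs psi, step_spec H be D Zs psi.
Proof.
move=> cH H0 be_inj be_P o_P be_all.
have [Zs hZs] := least_members cH H0.
have ZsY i : Ys i (Zs i) by case: (hZs i).
have ZsH i : Zs i `<=` H by case: (hZs i).
have Zs_disj i j y : Zs i y -> Zs j y -> i = j.
  by move=> zi zj; have [] := Ys_eq (ZsY i) (ZsY j) zi zj.
pose K := [set y | exists i, Zs i y].
have [Phi [PhiP Phi_inj Phi_surj Phi_cont]] := core_map o (fun i => Ys_closed (ZsY i))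
  Zs_disj (fun i => Ys_homeo (ZsY i)) P_homeo.
have [e [eC einj eS]] := child_enumeration W_csat W_all cH ZsY ZsH.
have e_bij : set_bij [set: nat] (child W H Zs) e by split.
have ech n : child W H Zs (e n) by exact: eC.
have ein m n y : e m y -> e n y -> m = n.
  by move=> my ny; apply: einj; rewrite ?inE //; exact: child_disj my ny.
have [y0 Ky0] : K !=set0.
  by have [y Zy] := Ys_neq0 (ZsY (Ordinal hk)); exists y, (Ordinal hk).
have [a Ka ha] : exists2 a : nat -> Y, (forall n, K (a n)) &
    forall eps : R, 0 < eps -> exists N, forall n, (N <= n)%N ->
      forall c, e n c -> ball (a n) eps c.
  apply: (@near_selection R Y K (fun n a eps => forall c, e n c -> ball a eps c)).
  - by exists y0.
  - by move=> n x r r' rr' h c /h; exact: le_ball.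
  - by move=> eps eps0; exact: (child_null W_csat W_all cH ZsY e_bij eps0).
have nPK y : K y -> ~ P (Phi y) by case=> i; exact: PhiP.
have [r nPr hr] : exists2 r : nat -> E, (forall n, (~` P) (r n)) &
    forall eps : R, 0 < eps -> exists N, forall n, (N <= n)%N -> ball (r n) eps (be n).
  apply: (@near_selection R E (~` P) (fun n q eps => ball q eps (be n))).
  - by exists (Phi y0); exact: nPK.
  - by move=> n x r r' rr'; exact: le_ball.
  - by move=> eps eps0; exact: (periph_null cE P_open1 be_inj be_P o_P be_all eps0).
have [s [t [sK tK hst]]] : exists s t : nat -> nat, [/\ cancel s t, cancel t s &
    forall eps : R, 0 < eps -> exists N, forall n, (N <= n)%N ->
      ball (Phi (a n)) eps (r (s n))].
  apply: (@matching R E (~` P) (fun n => Phi (a n)) r) => //.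
  - by move=> n; exact: nPK.
  - move=> q eps N nPq eps0; have [i [x [Zx xq]]] := Phi_surj q nPq.
    have : \forall y \near x, K y -> ball q eps (Phi y).
      by apply: (Phi_cont i x) => //; rewrite xq; exact: nbhsx_ballx.
    move=> /nbhs_ballP [d /= d0 hd].
    have [N1 hN1] := ha (d / 2) ltac:(lra).
    have [||n Nn [c ec xc]] := child_near W_csat W_all cH ZsY ZsH e_bij
       (x := x) (eps := d / 2) (maxn N N1); [by exists i|lra|].
    move: Nn; rewrite geq_max => /andP [Nn N1n]; exists n => //.
    apply: hd => //; rewrite [d]splitr; apply: ball_triangle xc _.
    by apply: ball_sym; exact: hN1.
  - move=> q eps N nPq eps0.
    have e20 : 0 < eps / 2 by lra.
    have [N2 hN2] := hr _ e20.
    have [n Nn qn] := periph_acc hE P_dense be_P o_P be_all (maxn N N2) nPq e20.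
    move: Nn; rewrite geq_max => /andP [Nn N2n]; exists n => //.
    rewrite [eps]splitr; apply: ball_triangle qn _.
    by apply: ball_sym; exact: hN2.
have enK n y : e n y -> ~ K y by move=> en; exact: child_notcore (ech n) en.
have /choice [psi hpsi] : forall y, exists q, (K y -> q = Phi y) /\
    (forall n, e n y -> q = be (s n)).
  move=> y; have [[n en]|no] := pselect (exists n, e n y).
    exists (be (s n)); split => [Ky|m em]; first by case: (enK n y en).
    by rewrite (ein _ _ _ en em).
  by exists (Phi y); split => // n en; case: no; exists n.
have psiK y i : Zs i y -> psi y = Phi y by move=> Zy; apply: (hpsi y).1; exists i.
have psie y n : e n y -> psi y = be (s n) by exact: (hpsi y).2.
have e_cover y : H y -> K y \/ exists n, e n y.
  move=> Hy; have [Ky|nKy] := pselect (K y); [by left|right].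
  have [D cD Dy] := child_cover W_csat W_all cH ZsY Hy nKy.
  by have [n _ en] := eS D cD; exists n; rewrite en.
(* Children are renumbered by the inverse [t] of [s], so that the [n]-th one goes to [be n]. *)
exists (fun n => e (t n)), Zs, psi; split => //.
- by move=> i; case: (hZs i).
- by move=> n; exact: (child_csat W_csat (ech (t n))).
- by move=> n; exact: (child_neq0 (ech (t n))).
- by move=> n; exact: (child_sub (ech (t n))).
- by move=> n y i en Zy; apply: (enK _ _ en); exists i.
- by move=> n y en; exact: (child_atom (ech (t n)) en).
- by move=> y /e_cover [|[n en]]; [left|right; exists (s n); rewrite sK].
- by move=> n y en; rewrite (psie _ _ en) tK.
- by move=> i y Zy; rewrite (psiK _ _ Zy); exact: PhiP Zy.
- by move=> i i' y y' Zy Zy'; rewrite (psiK _ _ Zy) (psiK _ _ Zy'); exact: Phi_inj Zy Zy'.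
- by move=> q /Phi_surj [i [y [Zy yq]]]; exists i, y; rewrite (psiK _ _ Zy).
move=> y Hy U; have [[n en]|no] := pselect (exists n, e n y).
  move=> /nbhs_singleton; rewrite (psie _ _ en) => Ub.
  have : \forall y' \near y, e n y'.
    by apply: open_nbhs_nbhs; split => //; case: (child_csat W_csat (ech n)) => -[].
  by apply: filterS => y' en'; rewrite /= (psie _ _ en').
have [[i Zy]|//] := e_cover y Hy.
rewrite (psiK _ _ Zy) => /nbhs_ballP [eps /= eps0 epsU].
(* The error has three parts: from [Phi y] to [Phi (a n)], then to [r (s n)], then to [be (s n)]. *)
have e30 : 0 < eps / 3 by lra.
have /nbhs_ballP [d /= d0 hd] : \forall y' \near y, K y' -> ball (Phi y) (eps / 3) (Phi y').
  by apply: (Phi_cont i y) => //; exact: nbhsx_ballx.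
have d20 : 0 < d / 2 by lra.
have [N1 hN1] := ha _ d20; have [N2 hN2] := hst _ e30; have [N3 hN3] := hr _ e30.
have [N4 hN4] := injective_tendsto (can_inj sK) N3.
pose N := maxn N1 (maxn N2 N4).
(* The children of index below [N] are closed and miss the core point [y]. *)
have n1 : \forall y' \near y, forall n, `I_N n -> ~ e n y'.
  apply: near_finite (finite_II N) _ => n _.
  apply: open_nbhs_nbhs; split; last by move=> en; apply: no; exists n.
  by apply: closed_openC; case: (child_csat W_csat (ech n)) => -[].
have n2 : \forall y' \near y, H y' by apply: open_nbhs_nbhs; split => //; case: cH => -[].
have n3 : \forall y' \near y, ball y (d / 2) y' by exact: nbhsx_ballx.
suff : \forall y' \near y, U (psi y') by [].
near=> y'; have yy' : ball y (d / 2) y' by near: y'.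
have Hy' : H y' by near: y'.
apply: epsU; case: (e_cover y' Hy') => [Ky'|[n en]].
  rewrite (hpsi y').1 //; apply: le_ball (hd y' _ Ky'); first lra.
  by apply: le_ball yy'; lra.
have Nn : (N <= n)%N.
  rewrite leqNgt; apply/negP => nN.
  by have : ~ e n y' by move: n nN {en}; near: y'.
move: Nn; rewrite !geq_max => /and3P [N1n N2n N4n].
rewrite (psie _ _ en).
have b1 : ball (Phi y) (eps / 3) (Phi (a n)).
  apply: hd => //; rewrite [d]splitr; apply: ball_triangle yy' _.
  by apply: ball_sym; exact: hN1.
have b2 := ball_triangle (ball_triangle b1 (hN2 n N2n)) (hN3 _ (hN4 _ N4n)).
by apply: le_ball b2; lra.
Unshelve. all: by end_near. Qed.

(** * Regions indexed by the tree *)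

Section Regions.
Variable b : vertex -> vertex -> E.
Hypothesis hb : forall t, set_bij [set s | adjb t s] P (b t).
Hypothesis idx_inj : forall p q : 'I_k * set Y,
  Ys p.1 p.2 -> Ys q.1 q.2 -> idx p = idx q -> p = q.
Hypothesis Y_neq0 : [set: Y] !=set0.

Let parent (t : vertex) : vertex := take (size t).-1 t.
Let be (t : vertex) (n : nat) : E := b t (rcons t n).

Let parent_rcons t n : parent (rcons t n) = t.
Proof. by rewrite /parent size_rcons -cats1 take_size_cat. Qed.

Let bP t s : adjb t s -> P (b t s).
Proof. by have [+ _ _] := hb t; apply. Qed.

Let b_inj t s s' : adjb t s -> adjb t s' -> b t s = b t s' -> s = s'.
Proof. by move=> ts ts'; have [_ inj _] := hb t; apply: inj; rewrite inE. Qed.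

Lemma step_vertex t H : csat H -> H !=set0 ->
  exists D Zs psi, step_spec H (be t) D Zs psi.
Proof.
move=> cH H0.
have [o [Po ho]] : exists o, P o /\ forall p, P p -> p = o \/ exists n, be t n = p.
  have hp p : P p -> (exists n, be t n = p) \/ exists s n, t = rcons s n /\ b t s = p.
    move=> Pp; have [_ _ /(_ p Pp) [s /= ts <-]] := hb t.
    by case/adjbP: ts => -[n e]; [left; exists n; rewrite e|right; exists s, n].
  have [[s [n e]]|no] := pselect (exists s n, t = rcons s n).
    exists (b t s); split; first by apply: bP; rewrite e adjbC adjb_rcons.
    move=> p /hp [|[s' [n' [e' <-]]]]; [by right|left].
    by move: e'; rewrite {1}e => /rcons_inj [->].
  exists (be t 0); split; first by apply: bP; exact: adjb_rcons.
  by move=> p /hp [|[s [n [e _]]]]; [right|case: no; exists s, n].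
apply: (@step_exists H (be t) o) => //.
  by move=> m n /b_inj; rewrite !adjb_rcons => /(_ isT isT) /rcons_inj [].
by move=> n; apply: bP; exact: adjb_rcons.
Qed.

Section Choice.
Variable st : vertex -> set Y -> (nat -> set Y) * ('I_k -> set Y) * (Y -> E).
Hypothesis hst : forall t H, csat H -> H !=set0 ->
  step_spec H (be t) (st t H).1.1 (st t H).1.2 (st t H).2.

(** The fold also carries the vertex, since the step taken at a vertex depends on its points
    [be]. *)
Definition region (t : vertex) : set Y :=
  (foldl (fun (s : vertex * set Y) n => (rcons s.1 n, (st s.1 s.2).1.1 n))
     ([::], setT) t).2.

Lemma region_rcons t n : region (rcons t n) = (st t (region t)).1.1 n.
Proof.
rewrite /region; set f := (fun s n => _).
have f1 u : (foldl f ([::], setT) u).1 = u.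
  by elim/last_ind: u => // u m IH; rewrite foldl_rcons /= IH.
by rewrite foldl_rcons /= f1.
Qed.

Lemma region_csat_neq0 t : csat (region t) /\ region t !=set0.
Proof.
elim/last_ind: t => [|t n [ct t0]]; first by split => //; exact: csat_setT.
have sp := hst t ct t0; rewrite region_rcons.
by split; [exact: (step_csat sp n)|exact: (step_neq0 sp n)].
Qed.

Let core t := (st t (region t)).1.2.
Let val t := (st t (region t)).2.

Lemma region_spec t :
  step_spec (region t) (be t) (fun n => region (rcons t n)) (core t) (val t).
Proof.
have [ct t0] := region_csat_neq0 t; have := hst t ct t0.
by rewrite (_ : (fun n => _) = (st t (region t)).1.1) //; apply/funext => n; rewrite region_rcons.
Qed.

(* Off its region, a point is seen from [t] through the edge to the parent of [t]. *)
Definition psi t y : E := if `[< region t y >] then val t y else b t (parent t).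

Lemma psi_in t y : region t y -> psi t y = val t y.
Proof. by move=> ry; rewrite /psi asboolT. Qed.

Lemma psi_out t y : ~ region t y -> psi t y = b t (parent t).
Proof. by move=> ry; rewrite /psi asboolF. Qed.

Lemma psi_continuous t : continuous (psi t).
Proof.
have [[[ot clt] _] _] := region_csat_neq0 t.
move=> y U; have [ry|nry] := pselect (region t y).
  rewrite psi_in // => /(step_cont (region_spec t) ry) nU.
  have nr : \forall y' \near y, region t y' by apply: open_nbhs_nbhs.
  suff : \forall y' \near y, U (psi t y') by [].
  have {}nU : \forall y' \near y, U (val t y') by exact: nU.
  by near=> y'; rewrite psi_in; near: y'.
rewrite psi_out // => /nbhs_singleton Ub.
have nr : \forall y' \near y, (~` region t) y'.
  by apply: open_nbhs_nbhs; split => //; exact: closed_openC.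
suff : \forall y' \near y, U (psi t y') by [].
by apply: filterS nr => y' ry'; rewrite psi_out.
Unshelve. all: by end_near. Qed.

(** The value identifies the edge: core points have nonperipheral values, distinct children have
    distinct values, and points off the region get the value of the parent edge. *)
Lemma psi_child t n y : psi t y = b t (rcons t n) <-> region (rcons t n) y.
Proof.
have sp := region_spec t; split => [|ry]; last first.
  by rewrite psi_in; [exact: (step_D sp ry)|exact: (step_sub sp ry)].
have [ry|nry] := pselect (region t y).
  rewrite psi_in //; case: (step_cover sp ry) => [[i Zy] e|[m rm]].
    by case: (step_nP sp Zy); rewrite e; apply: bP; exact: adjb_rcons.
  rewrite (step_D sp rm) => /b_inj.
  by rewrite !adjb_rcons => /(_ isT isT) /rcons_inj [<-].
rewrite psi_out //; case: (lastP t) nry {sp} => [[]//|s m _].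
rewrite parent_rcons => /b_inj; rewrite adjbC !adjb_rcons => /(_ isT isT).
by move=> /(congr1 size); rewrite !size_rcons; lia.
Qed.

Lemma psi_parent t n y : psi (rcons t n) y = b (rcons t n) t <-> ~ region (rcons t n) y.
Proof.
set s := rcons t n; have sp := region_spec s.
have st' : adjb s t by rewrite adjbC adjb_rcons.
split => [+ ry|nry]; last by rewrite psi_out // /s parent_rcons.
rewrite psi_in //; case: (step_cover sp ry) => [[i Zy] e|[m rm]].
  by case: (step_nP sp Zy); rewrite e; apply: bP.
rewrite (step_D sp rm) => /b_inj; rewrite adjb_rcons st' => /(_ isT isT).
by move=> /(congr1 size); rewrite !size_rcons; lia.
Qed.

Lemma psi_coherent y : coherent b (psi^~ y).
Proof.
move=> t s /adjbP [] [n ->].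
  rewrite psi_child psi_parent; split; [by move=> r|exact: contrapT].
by rewrite psi_child psi_parent.
Qed.

(** The member selected in a child also competed at the parent, and it was not selected there
    because children avoid the core; so the least indices increase strictly down the tree. *)
Lemma size_least t i : (size t <= idx (i, core t i))%N.
Proof.
elim/last_ind: t => // t n IH; rewrite size_rcons.
have sp := region_spec t; have sp' := region_spec (rcons t n).
have sub : core (rcons t n) i `<=` region (rcons t n) := @step_memH _ _ _ _ _ sp' i.
have le := step_least sp (step_mem sp' i)
  (subset_trans sub (@step_sub _ _ _ _ _ sp n)).
apply: leq_ltn_trans IH _; rewrite ltn_neqAle le andbT; apply/eqP => e.
have [e'] := idx_inj (p := (i, core t i)) (q := (i, core (rcons t n) i))
  (step_mem sp i) (step_mem sp' i) e.
have [z Zz] := Ys_neq0 (step_mem sp' i).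
by apply: (step_ncore sp (sub z Zz) (i := i)); rewrite e'.
Qed.

(** A member that meets a region lies in it and competes there; hence it meets regions of bounded
    depth only. *)
Lemma region_size_idx t i Z y : Ys i Z -> Z y -> region t y -> (size t <= idx (i, Z))%N.
Proof.
move=> YZ Zy ry; apply: leq_trans (size_least t i) _.
apply: (step_least (region_spec t)) => //.
by apply: csat_sub YZ Zy ry; case: (region_csat_neq0 t).
Qed.

(** If the order of the atom did not increase from a region to its child, the child would contain
    the whole region, core included. *)
Lemma region_atom t y : region t y -> exists j, (size t <= j)%N /\ region t = atom W j y.
Proof.
elim/last_ind: t => [_|t n IH ry].
  by exists 0%N; split => //; apply/seteqP; split.
have sp := region_spec t.
have [j [tj ej]] := IH (step_sub sp ry); have [j' ej'] := step_atom sp ry.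
exists j'; split => //; rewrite size_rcons; apply: leq_ltn_trans tj _.
rewrite ltnNge; apply/negP => j'j.
pose i := Ordinal hk; have [z Zz] := Ys_neq0 (step_mem sp i).
have rz := step_memH sp Zz; apply: (step_ncore sp (n := n) (y := z) (i := i)) => //.
by rewrite ej'; apply: (atom_le j'j); rewrite -ej.
Qed.

Lemma psi_injective y y' : (forall t, psi t y = psi t y') -> y = y'.
Proof.
move=> e.
have rE t : region t y <-> region t y'.
  by case: (lastP t) => // s n; rewrite -!psi_child e.
have [[t [ry [i Zy]]]|no] := pselect (exists t, region t y /\ exists i, core t i y).
  have sp := region_spec t; have ry' := (rE t).1 ry.
  have := e t; rewrite !psi_in // => ee.
  case: (step_cover sp ry') => [[i' Zy']|[n rn]].
    exact: (step_inj sp Zy Zy' ee).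
  by case: (step_ncore sp ((rE _).2 rn) Zy).
(* If [y] lies in no core, the regions containing [y] descend forever; they contain [y'] as well. *)
have chain n : exists t, size t = n /\ region t y.
  elim: n => [|n [t [tn ry]]]; first by exists [::].
  case: (step_cover (region_spec t) ry) => [Zy|[m rm]].
    by case: no; exists t.
  by exists (rcons t m); rewrite size_rcons tn.
have [//|[i [Z [YZ Zy _]]]] : same y y'.
  apply: (@atom_same W W_all) => n; have [t [tn ry]] := chain n.
  have [j [tj ej]] := region_atom ry.
  by apply: (@atom_le W n j); [rewrite -tn|rewrite -ej; exact/rE].
(* A common member would meet regions of every depth. *)
have [t [tn ry]] := chain (idx (i, Z)).+1.
by have := region_size_idx YZ Zy ry; rewrite tn ltnn.
Qed.

Lemma psi_surjective x : coherent b x -> exists y, forall t, psi t y = x t.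
Proof.
(* A vertex of [U] does not see the family through its parent edge. Its coordinate is either
   nonperipheral, hence realised in its core, or points to a child that is again in [U]. *)
move=> cx; pose U := [set t : vertex | forall s n, t = rcons s n -> x t <> b t s].
have [[t [Ut nPt]]|no] := pselect (exists t, U t /\ ~ P (x t)).
  have sp := region_spec t; have [i [y [Zy yx]]] := step_surj sp nPt.
  have ry := step_memH sp Zy; exists y => s; apply/esym.
  by apply: (coherent_eq_nonP hb cx (psi_coherent y) (t := t)) => //; rewrite psi_in.
have /choice [f hf] : forall t, exists n, U t -> x t = b t (rcons t n) /\ U (rcons t n).
  move=> t; have [Ut|nU] := pselect (U t); last by exists 0%N.
  have Px : P (x t) by apply: contrapT => nP; apply: no; exists t.
  have [_ _ /(_ _ Px) [s /= ts xs]] := hb t.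
  case/adjbP: (ts) => -[n e]; last by case: (Ut s n e).
  exists n => _; rewrite -e; split => // s' n' es.
  have /rcons_inj [<- _] : rcons t n = rcons s' n' by rewrite -e.
  by apply/(cx t s).
pose c n := iter n (fun t => rcons t (f t)) [::].
have cU n : U (c n).
  by elim: n => [s n|n IH] /=; [case: s|case: (hf _ IH)].
have cs n : size (c n) = n by elim: n => //= n IH; rewrite size_rcons IH.
have xc n : x (c n) = b (c n) (c n.+1) by case: (hf _ (cU n)).
have csub m n : (m <= n)%N -> region (c n) `<=` region (c m).
  elim: n => [|n IH]; first by rewrite leqn0 => /eqP ->.
  rewrite leq_eqVlt => /orP [/eqP -> //|/IH]; apply: subset_trans.
  exact: (step_sub (region_spec (c n))).
(* The regions along the ray are nonempty, closed and nested, so compactness gives a common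
   point. *)
have [y ry] : exists y, forall n, region (c n) y.
  apply: contrapT => none.
  have [||N hN] := @compact_nat_cover Y setT (fun n => ~` region (c n)) hYc.
  - by move=> n; apply: closed_openC; have [[[]]] := region_csat_neq0 (c n).
  - by move=> z _; apply: contrapT => h; apply: none; exists z => n;
      apply: contrapT => nr; apply: h; exists n.
  have [_ [z rz]] := region_csat_neq0 (c N).
  by have [n nN] := hN z I; apply; apply: csub rz; exact: ltnW.
exists y; apply: (coherent_eq_end hb (psi_coherent y) cx cs) => //.
  by move=> n; exists (f (c n)).
by move=> n; apply/psi_child; exact: ry n.+1.
Qed.

End Choice.

Lemma homeomorphic_amalgam_of_family : homeomorphic Y (set_type (@dense_amalgam_set E b)).
Proof.
have /choice [st hst] : forall tH : vertex * set Y,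
    exists s : (nat -> set Y) * ('I_k -> set Y) * (Y -> E),
    csat tH.2 -> tH.2 !=set0 -> step_spec tH.2 (be tH.1) s.1.1 s.1.2 s.2.
  move=> [t H]; have [[cH H0]|no] := pselect (csat H /\ H !=set0).
    by have [D [Zs [f sp]]] := step_vertex t cH H0; exists (D, Zs, f).
  have [y0 _] := Y_neq0.
  by exists (fun=> setT, fun=> setT, fun=> b [::] [::]) => cH H0; case: no.
pose st' t H := st (t, H).
have hst' t H : csat H -> H !=set0 ->
  step_spec H (be t) (st' t H).1.1 (st' t H).1.2 (st' t H).2 by exact: (hst (t, H)).
apply: (homeomorphic_dense_amalgam hb hE P_open1 (psi := psi st')) => //.
- exact: psi_continuous hst'.
- exact: psi_coherent hst'.
- exact: psi_injective hst'.
- exact: psi_surjective hst'.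
Qed.

End Regions.
End Step.
End Decomposition.

(** * The homeomorphism for an arbitrary tree system *)

Theorem theorem0p2
  (R : realType) (k : nat) (hk : (0 < k)%N)
  (X : 'I_k -> pseudoMetricType R)
  (hXh : forall i, hausdorff_space (X i))
  (hXc : forall i, compact [set: X i])
  (hXn : forall i, [set: X i] !=set0)
  (Y : pseudoMetricType R)
  (hYh : hausdorff_space Y) (hYc : compact [set: Y])
  (Ys : 'I_k -> set (set Y))
  (* the family Y = Y_1 ⊔ ... ⊔ Y_k, members indexed as pairs (i, Z) with Z ∈ Y_i *)
  (hcount : countable [set p : 'I_k * set Y | Ys p.1 p.2])
  (hinf : infinite_set [set p : 'I_k * set Y | Ys p.1 p.2])
  (* (a1) *)
  (ha1_disj : forall p q : 'I_k * set Y, Ys p.1 p.2 -> Ys q.1 q.2 -> p <> q ->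
      p.2 `&` q.2 = set0)
  (ha1_homeo : forall i (Z : set Y), Ys i Z -> homeomorphic (set_type Z) (X i))
  (* (a2) null family *)
  (ha2 : forall e : R, 0 < e ->
      finite_set [set p : 'I_k * set Y | Ys p.1 p.2 /\
        exists x y, [/\ p.2 x, p.2 y & ~ ball x e y]])
  (* (a3) *)
  (ha3 : forall i (Z : set Y), Ys i Z -> dense (~` Z))
  (* (a4) *)
  (ha4 : forall i, dense (\bigcup_(Z in Ys i) Z))
  (* (a5) *)
  (ha5 : forall x y : Y, x <> y ->
      ~ (exists i (Z : set Y), [/\ Ys i Z, Z x & Z y]) ->
      exists H : set Y, [/\ clopen H,
        (forall i (Z : set Y), Ys i Z -> Z `<=` H \/ Z `&` H = set0),
        H x & ~ H y]) :
  (* conclusion: Y is homeomorphic to the dense amalgam of X_1, ..., X_k,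
     computed from an arbitrary complete tree system of peripheral extensions
     of X_1 ⊔ ... ⊔ X_k *)
  forall (Ex : pseudoMetricType R) (P : set Ex),
    hausdorff_space Ex -> compact [set: Ex] ->
    countable P -> infinite_set P ->
    (forall p, P p -> exists U : set Ex, open U /\ U `&` P = [set p]) ->
    open P -> dense P ->
    homeomorphic (set_type (~` P)) {i : 'I_k & X i} ->
  forall b : vertex -> vertex -> Ex,
    (forall t, set_bij [set s | adjb t s] P (b t)) ->
  homeomorphic Y (set_type (@dense_amalgam_set _ b)).
Proof.
move=> Ex P hEh hEc _ _ hPi hPo hPd hP b hb.
have /countable_injP [idx idx_inj] := hcount.
have Y0 : [set: Y] !=set0.
  have [[i Z] /= YZ] := infinite_setN0 hinf.
  have [_ [g _]] := ha1_homeo i Z YZ.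
  by have [x _] := hXn i; exists (set_val (g x)).
have Ys_closed i Z : Ys i Z -> closed Z.
  move=> /ha1_homeo [f [g [fK _ _ cg]]]; apply: compact_closed => //.
  have -> : Z = (fun x => set_val (g x)) @` [set: X i].
    apply/seteqP; split => [z Zz|_ [x _ <-]]; last exact: set_valP.
    by exists (f (SigSub (mem_set Zz))) => //; rewrite fK.
  apply: continuous_compact (hXc i); apply: continuous_subspaceT => x.
  apply: (@continuous_comp _ _ _ g set_val); [exact: cg|exact: initial_continuous].
have Ys_neq0 i Z : Ys i Z -> Z !=set0.
  move=> /ha1_homeo [f [g _]]; have [x _] := hXn i.
  by exists (set_val (g x)); exact: set_valP.
have P1 p : P p -> open [set p].
  by move=> /hPi [U [oU <-]]; exact: openI.
have [W [W_csat W_all]] := csat_enumeration Ys hYc (projT1 (cid Y0)).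
apply: (homeomorphic_amalgam_of_family hk hYh hYc ha1_disj Ys_closed Ys_neq0 ha2
  ha3 ha4 ha5 hEh hEc P1 hPd ha1_homeo hP W_csat W_all hb (idx := idx)) => //.
by move=> p q hp hq; apply: idx_inj; rewrite inE.
Qed.
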